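(* Let $\eta=+1$ for the $+$ families and $\eta=-1$ for the $-$ families (with $n$ in the range where $DC_i^{\pm}(n,q)$ is defined), write $A_i=A_i^{\pm}(n,q)$, $B_i=B_i^{\pm}(n,q)$, $N_i=A_iB_i$, and let $C_{i,j}$ be the number of codewords of Hamming weight $j$ in $C(DC_i^{\pm}(n,q))$. In each formula below the sum runs over all families of nonnegative integers $\{\nu_\beta\}_{\beta\in\mathbb F_q},\{\mu_\beta\}_{\beta\in\mathbb F_q}$ with $\sum_\beta\nu_\beta+\sum_\beta\mu_\beta=j$ and $\sum_\beta\nu_\beta\beta=\sum_\beta\mu_\beta\beta$ in $\mathbb F_q$. Then for $0\le j\le N_i$: (1) for $i=1,3$: $$C_{i,j}=\sum\binom{q^{-1}A_i(B_i+\eta)}{\nu_1,\mu_1}\binom{q^{-1}A_i(B_i+\eta)}{\nu_{-1},\mu_{-1}}\prod_{\beta:\ \beta^2-1\ne0\text{ square}}\binom{q^{-1}A_i(B_i+\eta(q+1))}{\nu_\beta,\mu_\beta}\prod_{\beta:\ \beta^2-1\text{ nonsquare}}\binom{q^{-1}A_i(B_i+\eta(1-q))}{\nu_\beta,\mu_\beta};$$ (2) $C_{2,j}=\sum\prod_{\beta\in\mathbb F_q}\binom{q^{-1}A_2(B_2+\eta((q-1)^2-q\delta(2,q;\beta)))}{\nu_\beta,\mu_\beta}$; (3) $C_{4,j}=\sum\binom{q^{-1}A_4(B_4-\eta(q\delta(2,q;0)+(q-1)^3))}{\nu_0,\mu_0}\prod_{\beta\ne0}\binom{q^{-1}A_4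(B_4-\eta(q\delta(2,q;\beta)-2q^2+3q-1))}{\nu_\beta,\mu_\beta}$.
   Context: $q=3^s$. For nonnegative integers $a,b,c$: $\binom{c}{a,b}=\frac{c!}{a!\,b!\,(c-a-b)!}$ if $a+b\le c$ and $0$ otherwise. $\delta(2,q;\beta)=|\{(\alpha_1,\alpha_2)\in(\mathbb F_q^* )^2:\alpha_1+\alpha_1^{-1}+\alpha_2+\alpha_2^{-1}=\beta\}|$. Fix a nonsquare $\epsilon\in\mathbb F_q^*$, $\delta_\epsilon=\mathrm{diag}(1,-\epsilon)$, $J=\begin{bmatrix}0&1_{n-1}&0\\1_{n-1}&0&0\\0&0&\delta_\epsilon\end{bmatrix}$, $O^-(2n,q)=\{w\in GL(2n,q):{}^twJw=J\}$, $SO^-$ its determinant-one subgroup. $Q=Q(2n,q)$: products $\begin{bmatrix}A&0&0\\0&{}^tA^{-1}&0\\0&0&i\end{bmatrix}\begin{bmatrix}1_{n-1}&B&-{}^th\delta_\epsilon\\0&1_{n-1}&0\\0&h&1_2\end{bmatrix}$, $A\in GL(n-1,q)$, $i\in SO^-(2,q)$, ${}^tB+B+{}^th\delta_\epsilon h=0$. $\rho=\mathrm{diag}(1_{n-1},1_{n-1},1,-1)$, $\sigma_r=\begin{bmatrix}0&0&1_r&0&0\\0&1_{n-1-r}&0&0&0\\1_r&0&0&0&0\\0&0&0&1_{n-1-r}&0\\0&0&0&0&1_2\end{bmatrix}$. $DC_1^+=Q\sigma_{n-1}Q$, $DC_2^+=Q\sigma_{n-2}Q$, $DC_3^+=\rho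 Q\sigma_{n-2}Q$ ($n\ge2$ even), $DC_4^+=\rho Q\sigma_{n-3}Q$ ($n\ge4$ even), $DC_1^-=Q\sigma_{n-1}Q$ ($n\ge1$ odd), $DC_2^-=Q\sigma_{n-2}Q$, $DC_3^-=\rho Q\sigma_{n-2}Q$, $DC_4^-=\rho Q\sigma_{n-3}Q$ ($n\ge3$ odd). For $D=DC_i^{\pm}(n,q)$, $N=|D|$, ordering $g_1,\dots,g_N$: $C(D)=\{u\in\mathbb F_3^N:\sum_ju_j\mathrm{Tr}(g_j)=0\text{ in }\mathbb F_q\}$. Constants (empty products $=1$, $\left[{m\atop r}\right]_q=\prod_{j=0}^{r-1}\frac{q^{m-j}-1}{q^{r-j}-1}$): $A_1^+=q^{(5n^2-2n-4)/4}(q^{n-1}-1)\prod_{j=1}^{(n-2)/2}(q^{2j-1}-1)$, $B_1^+=(q+1)q^{n^2/4}\prod_{j=1}^{(n-2)/2}(q^{2j}-1)$; $A_2^+=q^{(5n^2-2n-8)/4}\left[{n-1\atop1}\right]_q\prod_{j=1}^{(n-2)/2}(q^{2j-1}-1)$, $B_2^+=(q+1)q^{(n-2)^2/4}(q^{n-1}-1)\prod_{j=1}^{(n-2)/2}(q^{2j}-1)$; $A_3^+=(q+1)A_2^+$, $B_3^+=q^{(n-2)^2/4}(q^{n-1}-1)\prod_{j=1}^{(n-2)/2}(q^{2j}-1)$; $A_4^+=(q+1)q^{(5n^2-6n-4)/4}\left[{n-1\atop2}\right]_q\prod_{j=1}^{(n-2)/2}(q^{2j-1}-1)$, $B_4^+=B_3^+$;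 $A_1^-=q^{5(n^2-1)/4}\prod_{j=1}^{(n-1)/2}(q^{2j-1}-1)$, $B_1^-=(q+1)q^{(n-1)^2/4}\prod_{j=1}^{(n-1)/2}(q^{2j}-1)$; $A_2^-=q^{(5n^2-4n-5)/4}\left[{n-1\atop1}\right]_q\prod_{j=1}^{(n-1)/2}(q^{2j-1}-1)$, $B_2^-=B_1^-$; $A_3^-=(q+1)A_2^-$, $B_3^-=q^{(n-1)^2/4}\prod_{j=1}^{(n-1)/2}(q^{2j}-1)$; $A_4^-=(q+1)q^{(5n^2-4n-9)/4}\left[{n-1\atop2}\right]_q\prod_{j=1}^{(n-3)/2}(q^{2j-1}-1)$, $B_4^-=q^{(n-3)^2/4}(q^{n-2}-1)(q^{n-1}-1)\prod_{j=1}^{(n-3)/2}(q^{2j}-1)$. *)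

(* Defs.v *)
From HB Require Import structures.
From mathcomp Require Import all_boot all_order all_algebra.
Set Implicit Arguments. Unset Strict Implicit. Unset Printing Implicit Defensive.
Import Order.TTheory GRing.Theory Num.Theory.
Local Open Scope ring_scope.

Section Defs.
Variable F : finFieldType.

Definition issq (x : F) : bool := [exists y : F, y * y == x].

Definition delta2 (b : F) : nat :=
  #|[set p : F * F | [&& p.1 != 0, p.2 != 0 &
       p.1 + p.1^-1 + p.2 + p.2^-1 == b]]|.

(* Matrices of size 2n are indexed by (n-1) + (n-1) + 2. *)
Notation dim n := (n.-1 + n.-1 + 2)%N.

Definition deltaeps (eps : F) : 'M[F]_2 :=
  \matrix_(i < 2, j < 2) (if (i == j) then (if (i == 0 :> nat)%N then 1 else - eps) else 0).

Definition Jmx (n : nat) (eps : F) : 'M[F]_(dim n) :=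
  block_mx (block_mx 0 1%:M 1%:M 0) 0 0 (deltaeps eps).

Definition SOm2 (eps : F) : {set 'M[F]_2} :=
  [set i : 'M[F]_2 | (i^T *m deltaeps eps *m i == deltaeps eps) && (\det i == 1)].

Definition levi (n : nat) (A : 'M[F]_(n.-1)) (i : 'M[F]_2) : 'M[F]_(dim n) :=
  block_mx (block_mx A 0 0 (invmx A)^T) 0 0 i.

Definition unip (n : nat) (eps : F) (B : 'M[F]_(n.-1)) (h : 'M[F]_(2, n.-1))
  : 'M[F]_(dim n) :=
  block_mx (block_mx 1%:M B 0 1%:M) (col_mx (- (h^T *m deltaeps eps)) 0)
           (row_mx 0 h) 1%:M.

Definition Qgrp (n : nat) (eps : F) : {set 'M[F]_(dim n)} :=
  [set w : 'M[F]_(dim n) |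
    [exists A : 'M[F]_(n.-1), [exists i : 'M[F]_2,
     [exists B : 'M[F]_(n.-1), [exists h : 'M[F]_(2, n.-1),
       [&& A \in unitmx, i \in SOm2 eps,
           B^T + B + h^T *m deltaeps eps *m h == 0 &
           w == levi A i *m unip eps B h]]]]]].

Definition rho (n : nat) : 'M[F]_(dim n) :=
  \matrix_(i, j) (if i == j then (if (i == (dim n).-1 :> nat)%N then -1 else 1) else 0).

Definition sigma_swap (n r x : nat) : nat :=
  if (x < r)%N then (x + n.-1)%N
  else if (n.-1 <= x < n.-1 + r)%N then (x - n.-1)%N else x.

Definition sigma (n r : nat) : 'M[F]_(dim n) :=
  \matrix_(i, j) (if (j == sigma_swap n r i :> nat) then 1 else 0).

Definition dcoset (n : nat) (eps : F) (r : nat) : {set 'M[F]_(dim n)} :=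
  [set (a *m sigma n r) *m b | a in Qgrp n eps, b in Qgrp n eps].

(* DC_i^{+-}(n,q): the defining formulas coincide for both families *)
Definition DC (i n : nat) (eps : F) : {set 'M[F]_(dim n)} :=
  match i with
  | 1 => dcoset n eps n.-1
  | 2 => dcoset n eps (n.-1).-1
  | 3 => [set rho n *m g | g in dcoset n eps (n.-1).-1]
  | _ => [set rho n *m g | g in dcoset n eps ((n.-1).-1).-1]
  end.

Definition codeC (k : nat) (D : {set 'M[F]_k}) : {set {ffun 'I_#|D| -> 'F_3}} :=
  [set u : {ffun 'I_#|D| -> 'F_3} |
     \sum_(j < #|D|) ((u j : nat)%:R * \tr (enum_val j)) == 0].

Definition hweight m (u : {ffun 'I_m -> 'F_3}) : nat := #|[set j | u j != 0]|.

Definition Ccount (k : nat) (D : {set 'M[F]_k}) (w : nat) : nat :=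
  #|[set u in codeC D | hweight u == w]|.

Definition famsum (j : nat) (f : (F -> nat) -> (F -> nat) -> nat) : nat :=
  (\sum_(nu : {ffun F -> 'I_j.+1})
     \sum_(mu : {ffun F -> 'I_j.+1} |
        ((\sum_(b : F) (nu b : nat)) + (\sum_(b : F) (mu b : nat)) == j)%N &&
        ((\sum_(b : F) b *+ nu b)%R == (\sum_(b : F) b *+ mu b)%R))
     f (fun b => nu b : nat) (fun b => mu b : nat))%N.

End Defs.

Definition multi (c : rat) (a b : nat) : nat :=
  if c \is a Num.nat_num then
    let k := Num.truncn c in
    if (a + b <= k)%N then (k`! %/ (a`! * b`! * (k - a - b)`!))%N else 0%N
  else 0%N.

Section Consts.
Variable q : rat.
Definition prododd (k : nat) : rat := \prod_(1 <= j < k.+1) (q ^+ (2 * j - 1) - 1).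
Definition prodeven (k : nat) : rat := \prod_(1 <= j < k.+1) (q ^+ (2 * j) - 1).
Definition gauss (m r : nat) : rat :=
  \prod_(0 <= j < r) ((q ^+ (m - j) - 1) / (q ^+ (r - j) - 1)).

Definition Acst (pm : bool) (i n : nat) : rat :=
  if pm then
    match i with
    | 1 => q ^+ ((5 * n ^ 2 - 2 * n - 4) %/ 4) * (q ^+ (n - 1) - 1) * prododd ((n - 2) %/ 2)
    | 2 => q ^+ ((5 * n ^ 2 - 2 * n - 8) %/ 4) * gauss (n - 1) 1 * prododd ((n - 2) %/ 2)
    | 3 => (q + 1) * (q ^+ ((5 * n ^ 2 - 2 * n - 8) %/ 4) * gauss (n - 1) 1 * prododd ((n - 2) %/ 2))
    | _ => (q + 1) * q ^+ ((5 * n ^ 2 - 6 * n - 4) %/ 4) * gauss (n - 1) 2 * prododd ((n - 2) %/ 2)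
    end
  else
    match i with
    | 1 => q ^+ ((5 * (n ^ 2 - 1)) %/ 4) * prododd ((n - 1) %/ 2)
    | 2 => q ^+ ((5 * n ^ 2 - 4 * n - 5) %/ 4) * gauss (n - 1) 1 * prododd ((n - 1) %/ 2)
    | 3 => (q + 1) * (q ^+ ((5 * n ^ 2 - 4 * n - 5) %/ 4) * gauss (n - 1) 1 * prododd ((n - 1) %/ 2))
    | _ => (q + 1) * q ^+ ((5 * n ^ 2 - 4 * n - 9) %/ 4) * gauss (n - 1) 2 * prododd ((n - 3) %/ 2)
    end.

Definition Bcst (pm : bool) (i n : nat) : rat :=
  if pm then
    match i with
    | 1 => (q + 1) * q ^+ ((n ^ 2) %/ 4) * prodeven ((n - 2) %/ 2)
    | 2 => (q + 1) * q ^+ (((n - 2) ^ 2) %/ 4) * (q ^+ (n - 1) - 1) * prodeven ((n - 2) %/ 2)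
    | _ => q ^+ (((n - 2) ^ 2) %/ 4) * (q ^+ (n - 1) - 1) * prodeven ((n - 2) %/ 2)
    end
  else
    match i with
    | 1 | 2 => (q + 1) * q ^+ (((n - 1) ^ 2) %/ 4) * prodeven ((n - 1) %/ 2)
    | 3 => q ^+ (((n - 1) ^ 2) %/ 4) * prodeven ((n - 1) %/ 2)
    | _ => q ^+ (((n - 3) ^ 2) %/ 4) * (q ^+ (n - 2) - 1) * (q ^+ (n - 1) - 1)
             * prodeven ((n - 3) %/ 2)
    end.
End Consts.

(* range of n where DC_i^{+}(n,q) (pm = true) resp. DC_i^{-}(n,q) is defined *)
Definition valid (pm : bool) (i n : nat) : bool :=
  if pm then ~~ odd n && [|| (i \in [:: 1; 2; 3]%N) && (2 <= n)%N | (i == 4%N) && (4 <= n)%N]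
  else odd n && [|| (i == 1%N) && (1 <= n)%N | (i \in [:: 2; 3; 4]%N) && (3 <= n)%N].

Definition rhs (F : finFieldType) (pm : bool) (i n j : nat) : nat :=
  let q : rat := (#|F|)%:R in
  let A := Acst q pm i n in
  let B := Bcst q pm i n in
  let eta : rat := if pm then 1 else -1 in
  let c (x : rat) : rat := q^-1 * A * (B + x) in
  match i with
  | 1 | 3 =>
    famsum j (fun nu mu =>
      (multi (c eta) (nu (1%R : F)) (mu (1%R : F)) *
       multi (c eta) (nu ((-1)%R : F)) (mu ((-1)%R : F)) *
       (\prod_(b : F | ((b ^+ 2 - 1 != 0) && issq (b ^+ 2 - 1))%R)
          multi (c (eta * (q + 1))%R) (nu b) (mu b)) *
       (\prod_(b : F | (~~ issq (b ^+ 2 - 1))%R)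
          multi (c (eta * (1 - q))%R) (nu b) (mu b)))%N)
  | 2 =>
    famsum j (fun nu mu =>
      (\prod_(b : F)
         multi (c (eta * ((q - 1) ^+ 2 - q * (delta2 b)%:R))%R) (nu b) (mu b))%N)
  | _ =>
    famsum j (fun nu mu =>
      (multi (c (- (eta * (q * (delta2 (0%R : F))%:R + (q - 1) ^+ 3)))%R) (nu 0%R) (mu 0%R) *
       \prod_(b : F | (b != 0)%R)
         multi (c (- (eta * (q * (delta2 b)%:R - 2 * q ^+ 2 + 3 * q - 1)))%R) (nu b) (mu b))%N)
  end.

(* Main.v *)
(* A codeword of weight j is a pair of disjoint sets of positions (entries 1 and
   -1), so C_j only depends on the numbers of elements of D with a given trace.
   For a function f on a finite set, put dev c = q [c = 0] - 1; then
   sum_x dev (f x - b) = q #{f = b} - #X, and these sums behave under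
   convolution as character sums do.  As Q sigma_r Q is covered by Q x Q with
   constant fibres and the trace is invariant under conjugation, it suffices to
   sum dev over the elements w sigma_r with w in Q.  There the unipotent variable
   enters through an affine form, and the sum over it vanishes unless the Levi
   factor A in GL(n-1,q) is block lower triangular with a nonsingular symmetric
   upper left r x r block S.  What is left is a quadratic form in 2r variables, a sum
   of r scaled norm forms x^2 - eps y^2, which contributes the factor (-q)^r; then
   come the number of nonsingular symmetric matrices S and a sum over
   GL(n-1-r,q) x SO^-(2,q), which is elementary for n-1-r <= 2. *)

Require Import Defs.
From HB Require Import structures.
From mathcomp Require Import all_boot all_order all_algebra all_field.
From mathcomp Require Import zify ring.
Import Order.TTheory GRing.Theory Num.Theory.
Local Open Scope ring_scope.
Set Implicit Arguments.
Unset Strict Implicit.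
Unset Printing Implicit Defensive.

(** * Codewords and trace multiplicities *)

(** [dev c] is the sum of psi(c) over all nontrivial additive characters psi of the field. The sums
    of [dev] are thus Kloosterman-type and Gauss-type sums added up over psi: every value stays
    rational, and nothing is lost since only numbers of solutions are wanted. Characteristic 3
    enters through 2 = -1 and 4 = 1. The entry -1 of a codeword is read as 2; the equation a + 1/a =
    c has discriminant c^2 - 1, which is why the square class of beta^2 - 1 governs the cases i = 1,
    3; and the matrix equation B^T + B + H = 0 with H symmetric has the solution B = H. The
    constants come from two relations, A |Stab| = |Q| W u and B W u = |Q|, where Stab is the
    intersection of Q with sigma Q sigma, W is the absolute value of the factor in front of the Levi
    sum, and u is a factor common to all values of that sum: u = 1 for i = 1, 2, u = q + 1 for i = 3
    and u = q (q + 1) for i = 4. Then A B = |D|, and the number of elements of trace beta is q^-1 A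
    (B + x), with x the Levi sum divided by u, up to sign. *)

Lemma multi_natE (N a b : nat) :
  multi N%:R a b = ('C(N, a) * 'C(N - a, b))%N.
Proof.
rewrite /multi natr_nat natrK.
case: leqP => [leabN | ltNab].
  have leaN : (a <= N)%N by apply: leq_trans leabN; rewrite leq_addr.
  have lebN : (b <= N - a)%N by rewrite leq_subRL.
  have pos : (0 < a`! * b`! * (N - a - b)`!)%N by rewrite !muln_gt0 !fact_gt0.
  apply/eqP; rewrite -(eqn_pmul2r pos) divnK; last first.
    apply/dvdnP; exists ('C(N, a) * 'C(N - a, b))%N.
    rewrite -(bin_fact leaN) -(bin_fact lebN); ring.
  rewrite -(bin_fact leaN) -(bin_fact lebN); apply/eqP; ring.
case: (leqP a N) => [leaN | ltNa]; last by rewrite bin_small.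
by rewrite [X in (_ * X)%N]bin_small ?muln0 // ltn_subLR.
Qed.

(** A subset amounts to the family of its intersections with the fibres of [f], and these can be
    chosen independently; [split] and [join] pass between the two views. *)
Lemma card_subsets_fiberwise (I J : finType) (f : I -> J) (E : {set I})
    (nu : J -> nat) :
  #|[set P : {set I} | (P \subset E) &&
      [forall b, #|P :&: [set x | f x == b]| == nu b]]| =
  (\prod_b 'C(#|E :&: [set x | f x == b]|, nu b))%N.
Proof.
pose fib b := [set x : I | f x == b].
pose dr b := [set A : {set I} | (A \subset E :&: fib b) & #|A| == nu b].
pose split (P : {set I}) := [ffun b => P :&: fib b].
pose join (g : {ffun J -> {set I}}) := \bigcup_b g b.
have joinK : {in family (fun b => mem (dr b)), cancel join split}.
  move=> g /familyP gdr; apply/ffunP=> b; rewrite ffunE; apply/setP=> x.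
  rewrite !inE; apply/andP/idP => [[/bigcupP[c _ xgc] /eqP fx]|xgb].
    have := gdr c; rewrite inE => /andP[/subsetP/(_ x xgc)]; rewrite !inE.
    by case/andP=> _ /eqP fxc _; rewrite -fx fxc.
  split; first by apply/bigcupP; exists b => //; rewrite ?inE.
  have := gdr b; rewrite inE => /andP[/subsetP/(_ x xgb)]; rewrite !inE.
  by case/andP.
have splitK : cancel split join.
  move=> P; apply/setP=> x; apply/bigcupP/idP => [[b _]|xP].
    by rewrite ffunE => /setIP[].
  by exists (f x) => //; rewrite ffunE !inE xP eqxx.
transitivity #|family (fun b => mem (dr b))|.
  rewrite -(card_imset _ (can_inj splitK)); apply: eq_card => g.
  apply/imsetP/familyP => [[P]|gdr].
    rewrite inE => /andP[PE /forallP nuP] -> b.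
    by rewrite inE ffunE setSI //= nuP.
  have gfam : g \in family (fun b => mem (dr b)) by apply/familyP.
  exists (join g); last by rewrite joinK.
  rewrite inE; apply/andP; split.
    apply/bigcupsP=> b _; have := gdr b; rewrite inE => /andP[gs _].
    exact: subset_trans gs (subsetIl _ _).
  apply/forallP=> b; have := gdr b; rewrite inE => /andP[_].
  by rewrite -{1}(joinK _ gfam) ffunE.
rewrite card_family foldrE big_map enumT; apply: eq_bigr => b _.
exact: cards_draws.
Qed.

Section CodeCount.
Variables (F : finFieldType) (char3 : 3%:R = 0 :> F).

Lemma F3_cases (x : 'F_3) : [|| x == 0, x == 1 | x == -1].
Proof. by case: x => [[|[|[|]]]]. Qed.

(** [codeC] lifts an entry to a natural number, so -1 acts as 2; characteristic 3 turns this back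
    into -1. *)
Lemma natF3_mul (x : 'F_3) (y : F) :
  (x : nat)%:R * y = y *+ (x == 1) - y *+ (x == -1).
Proof.
have two : 2%:R = -1 :> F by by apply/eqP; rewrite -subr_eq0 opprK natr1 char3.
case/or3P: (F3_cases x) => /eqP-> /=; rewrite ?mul0r ?subrr ?mul1r ?subr0 //.
by rewrite two mulN1r sub0r.
Qed.

Lemma sum_mulrb (I : finType) (f : I -> F) (P : {set I}) :
  \sum_x f x *+ (x \in P) =
  \sum_b b *+ #|P :&: [set x | f x == b]|.
Proof.
rewrite (eq_bigr (fun x => \sum_(b | b == f x) b *+ (x \in P))); last first.
  by move=> x _; rewrite big_pred1_eq.
rewrite (exchange_big_dep xpredT) //=; apply: eq_bigr => b _.
rewrite -sumr_const big_mkcond /= [RHS]big_mkcond /=; apply: eq_bigr => x _.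
by rewrite !inE eq_sym; case: (f x == b) (x \in P) => [] [].
Qed.

Lemma card_fiberwise (I J : finType) (f : I -> J) (P : {set I}) :
  #|P| = (\sum_b #|P :&: [set x | f x == b]|)%N.
Proof.
rewrite -sum1_card (partition_big f xpredT) //=; apply: eq_bigr => b _.
by rewrite -sum1_card; apply: eq_bigl => x; rewrite !inE.
Qed.

Lemma eq_famsum j (f g : (F -> nat) -> (F -> nat) -> nat) :
  (forall nu mu, f nu mu = g nu mu) -> famsum j f = famsum j g.
Proof.
by move=> fg; rewrite /famsum; apply: eq_bigr => nu _; apply: eq_bigr => mu _.
Qed.

Lemma Ccount_famsum (k : nat) (D : {set 'M[F]_k}) (j : nat) :
  Ccount D j = famsum j (fun nu mu => \prod_(b : F)
    multi #|[set g in D | \tr g == b]|%:R (nu b) (mu b))%N.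
Proof.
set I := 'I_#|D|; pose f (x : I) : F := \tr (enum_val x).
pose N b := #|[set g in D | \tr g == b]|.
(* The bound built into ['I_j.+1] loses nothing: by [ok_le] no multiplicity exceeds the weight j, so
   [inord] never truncates. *)
pose pr (P : {set I}) : {ffun F -> 'I_j.+1} :=
  [ffun b => inord #|P :&: [set x | f x == b]|].
pose ok (nu mu : F -> nat) :=
  ((\sum_b nu b + \sum_b mu b == j)%N && (\sum_b b *+ nu b == \sum_b b *+ mu b)).
pose cn (P : {set I}) b := #|P :&: [set x | f x == b]|.
pose PM := [set X : {set I} * {set I} | [disjoint X.1 & X.2] & ok (cn X.1) (cn X.2)].
have ok_le nu mu : ok nu mu -> forall b, (nu b < j.+1)%N /\ (mu b < j.+1)%N.
  case/andP=> /eqP <- _ b; rewrite !ltnS; split.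
    by rewrite (bigD1 b) //= -addnA leq_addr.
  by rewrite [X in (_ + X)%N](bigD1 b) //= addnCA leq_addr.
have cN b : #|[set x | f x == b]| = N b.
  rewrite /N -(card_imset _ (@enum_val_inj _ _)); apply: eq_card => g.
  rewrite inE; apply/imsetP/andP => [[x] | [gD trg]].
    by rewrite inE => ? ->; rewrite enum_valP.
  exists (enum_rank_in gD g); last by rewrite enum_rankK_in.
  by rewrite inE /f enum_rankK_in.
have -> : Ccount D j = #|PM|.
  pose enc (u : {ffun I -> 'F_3}) := ([set x | u x == 1], [set x | u x == -1]).
  have enc_inj : injective enc.
    move=> u v [/setP e1 /setP e2]; apply/ffunP=> x.
    have := e1 x; have := e2 x; rewrite !inE.
    by case/or3P: (F3_cases (u x)) => /eqP->; case/or3P: (F3_cases (v x)) => /eqP->.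
  rewrite /Ccount -(card_imset _ enc_inj); apply: eq_card => X.
  have encok u : ok (cn (enc u).1) (cn (enc u).2) = (u \in codeC D) && (hweight u == j).
    rewrite /ok andbC; congr andb.
      rewrite inE (eq_bigr (fun x => f x *+ (u x == 1) - f x *+ (u x == -1))); last first.
        by move=> x _; rewrite natF3_mul.
      rewrite sumrB subr_eq0 -!sum_mulrb.
      by congr (_ == _); apply: eq_bigr => x _; rewrite inE.
    rewrite -!card_fiberwise /hweight.
    rewrite -cardsUI -[X in _ = (X == j)]addn0; congr (_ + _ == _)%N => /=.
      apply: eq_card => x; rewrite !inE.
      by case/or3P: (F3_cases (u x)) => /eqP->.
    apply: eq_card0 => x; rewrite !inE.
    by case/or3P: (F3_cases (u x)) => /eqP->.
  apply/imsetP/idP => [[u] |].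
    rewrite inE => uok ->; rewrite inE encok uok andbT.
    apply/pred0P=> x; rewrite /= !inE.
    by case/or3P: (F3_cases (u x)) => /eqP->.
  case: X => P M; rewrite inE /= => /andP[dPM okPM].
  pose u : {ffun I -> 'F_3} := [ffun x => if x \in P then 1 else if x \in M then -1 else 0].
  have uE : enc u = (P, M).
    congr pair; apply/setP=> x; rewrite !inE ffunE; first by case: (x \in P) (x \in M) => [] [].
    by case: ifP => [/(disjointFr dPM) ->|_]; case: (x \in M).
  by exists u => //; rewrite inE -encok uE.
rewrite /famsum -sum1_card.
rewrite (partition_big (fun X => pr X.1) xpredT) //=; apply: eq_bigr => nu _.
rewrite (partition_big (fun X => pr X.2)
  (fun mu : {ffun F -> 'I_j.+1} => ok (fun b => nu b) (fun b => mu b))) /=; last first.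
  move=> X /andP[]; rewrite inE => /andP[_ okX] /eqP<-.
  have le := ok_le _ _ okX.
  rewrite /ok in okX *; congr (is_true (_ && _)): okX; first congr (_ + _ == _)%N;
   try congr (_ == _); apply: eq_bigr => b _; rewrite ffunE inordK //; by case: (le b).
apply: eq_bigr => mu okm.
rewrite sum1_card.
(* Choose the positions P of the entry 1 first, then those of -1 in the complement. The second
   choice depends on P only through nu, since N b - nu b positions remain over b; this gives the two
   binomials of [multi_natE]. *)
transitivity (\sum_(P in [set P : {set I} | (P \subset setT) &&
   [forall b, cn P b == nu b]]) #|[set M : {set I} | (M \subset ~: P) &&
   [forall b, cn M b == mu b]]|)%N.
  rewrite -sum1_card (eq_bigr (fun P => \sum_(M in [set M : {set I} | (M \subset ~: P) &&
   [forall b, cn M b == mu b]]) 1)%N); last by move=> P _; rewrite sum1_card.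
  rewrite pair_big_dep /=; apply: eq_bigl => -[P M].
  rewrite unfold_in /= !inE /= subsetT /= -disjoints_subset disjoint_sym.
  have [dPM|_] := boolP [disjoint P & M]; last by rewrite /= andbF.
  rewrite /=; apply/andP/andP=> [[/andP[okc /eqP <-] /eqP <-]|[/forallP cP /forallP cM]].
    have le := ok_le _ _ okc.
    by split; apply/forallP=> b; rewrite ffunE inordK //; case: (le b).
  have cPE b : cn P b = nu b by apply/eqP.
  have cME b : cn M b = mu b by apply/eqP.
  split; last by apply/eqP/ffunP=> b; apply/val_inj; rewrite ffunE /= -/(cn M b) cME inord_val.
  rewrite andbC; apply/andP; split; first by apply/eqP/ffunP=> b; apply/val_inj;
    rewrite ffunE /= -/(cn P b) cPE inord_val.
  move: okm; rewrite /ok; congr (is_true (_ && _)); first congr (_ + _ == _)%N;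
   try congr (_ == _); by apply: eq_bigr => b _; rewrite ?cPE ?cME.
rewrite (eq_bigr (fun _ => \prod_b 'C(N b - nu b, mu b)))%N; last first.
  move=> P; rewrite inE => /andP[_ /forallP cP].
  rewrite card_subsets_fiberwise; apply: eq_bigr => b _; congr 'C(_, _).
  by rewrite setIC -setDE cardsD cN (setIC [set x | f x == b] P) -/(cn P b) (eqP (cP b)).
rewrite sum_nat_const card_subsets_fiberwise -big_split /=.
by apply: eq_bigr => b _; rewrite multi_natE setTI cN.
Qed.
End CodeCount.

(** * Counting over the field *)

Section Deviation.
Variable F : finFieldType.
Local Notation q := (#|F|%:R : rat).

Definition dev (c : F) : rat := q * (c == 0)%:R - 1.

Lemma card_field_neq0 : q != 0.
Proof. by rewrite pnatr_eq0 -lt0n; apply/card_gt0P; exists 0. Qed.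

Lemma devN c : dev (- c) = dev c.
Proof. by rewrite /dev oppr_eq0. Qed.

Lemma sum_dev_fiber (X : finType) (P : pred X) (f : X -> F) b :
  \sum_(x | P x) dev (f x - b) = q * #|[set x | P x & f x == b]|%:R - #|P|%:R.
Proof.
have -> : #|[set x | P x & f x == b]| = (\sum_(x | P x) (f x - b == 0)%R)%N.
  rewrite -sum1_card big_mkcond [RHS]big_mkcond /=.
  by apply: eq_bigr => x _; rewrite inE subr_eq0; case: (P x) (_ == _) => [] [].
by rewrite sumrB -mulr_sumr natr_sum sumr_const.
Qed.

Lemma sum_dev : \sum_(c : F) dev c = 0.
Proof.
rewrite sumrB -mulr_sumr sumr_const (bigD1 0) //= eqxx big1 => [|c /negPf->//].
by rewrite addr0 mulr1 subrr.
Qed.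

(** The bijections [g t] of S shift f by t, so the sum does not change when t is added to the
    argument. Averaging over t makes the argument run over the whole field, where [dev] sums to
    0. *)
Lemma sum_dev_linear (T : finType) (S : pred T)
    (f : T -> F) (g : F -> T -> T) (b : F) :
  (forall t, {homo g t : x / S x}) ->
  (forall t, cancel (g t) (g (- t))) ->
  (forall t x, f (g t x) = f x + t) ->
  \sum_(x | S x) dev (f x + b) = 0.
Proof.
move=> gS gK fg.
have eq_t t : \sum_(x | S x) dev (f x + b) = \sum_(x | S x) dev (f x + b + t).
  have gKt : cancel (g (- t)) (g t) by have := gK (- t); rewrite opprK.
  rewrite (reindex (g t)) /=; last by exists (g (- t)) => x _; [apply: gK | apply: gKt].
  apply: eq_big => [x|x _]; last by rewrite fg addrAC.
  by apply/idP/idP => [/(gS (- t))|/(gS t)//]; rewrite gK.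
suff : q * \sum_(x | S x) dev (f x + b) = 0.
  by move/eqP; rewrite mulf_eq0 (negPf card_field_neq0) => /eqP.
rewrite mulr_natl -sumr_const (eq_bigr _ (fun t _ => eq_t t)) exchange_big big1 //= => x _.
rewrite (reindex_inj (addrI (- (f x + b)))) /=.
rewrite (eq_bigl xpredT) // (eq_bigr dev) ?sum_dev // => t _.
by rewrite addNKr.
Qed.
End Deviation.

(** * Square roots, norm forms and the group SO^-(2,q) *)

Section Squares.
Variables (F : finFieldType).
Hypothesis two_neq0 : 2%:R != 0 :> F.
Variables (eps : F) (epsN : ~~ issq eps).
Local Notation q := (#|F|%:R : rat).

Definition nroots (c : F) : nat := #|[set y : F | y ^+ 2 == c]|.

Lemma eps_neq0 : eps != 0.
Proof.
by apply: contraNneq epsN => ->; apply/existsP; exists 0; rewrite mulr0.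
Qed.

Lemma nroots_sq y : y != 0 -> nroots (y ^+ 2) = 2%N.
Proof.
move=> y0; rewrite /nroots (eq_card (B := pred2 y (- y))); last first.
  by move=> x; rewrite !inE eqf_sqr.
by rewrite card2 -addr_eq0 -mulr2n -mulr_natl mulf_eq0 (negPf two_neq0) (negPf y0).
Qed.

Lemma nroots0 : nroots 0 = 1%N.
Proof.
rewrite /nroots (eq_card (B := pred1 0)) ?card1 // => x.
by rewrite !inE sqrf_eq0.
Qed.

Lemma nroots_nsq c : ~~ issq c -> nroots c = 0%N.
Proof.
move=> cN; apply: eq_card0 => y; rewrite inE; apply: contraNF cN => /eqP yc.
by apply/existsP; exists y; rewrite -expr2 yc.
Qed.

Lemma nroots_le2 c : (nroots c <= 2)%N.
Proof.
have [/existsP[y /eqP]|/nroots_nsq->//] := boolP (issq c).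
rewrite -expr2 => <-; have [->|/nroots_sq->//] := eqVneq y 0.
by rewrite expr0n nroots0.
Qed.

Lemma sum_nroots : (\sum_c nroots c = #|F|)%N.
Proof.
rewrite -[RHS]sum1_card [RHS](partition_big (fun y : F => y ^+ 2) xpredT) //=.
by apply: eq_bigr => c _; rewrite sum1_card /nroots cardsE.
Qed.

(* Each summand is at most 2, since c and c / eps cannot both be nonzero
   squares, while the sum over all c is 2q. *)
Lemma nroots_twist c : (nroots c + nroots (c / eps) = 2)%N.
Proof.
have le2 d : (nroots d + nroots (d / eps) <= 2)%N.
  have [->|d0] := eqVneq d 0; first by rewrite mul0r nroots0.
  have [/existsP[y /eqP yd]|/nroots_nsq->] := boolP (issq d); last exact: nroots_le2.
  rewrite [X in (_ + X)%N]nroots_nsq ?addn0 ?nroots_le2 //.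
  apply: contra epsN => /existsP[z /eqP zd]; apply/existsP; exists (y / z).
  have z0 : z != 0.
    apply: contraNneq d0 => z0; move: zd; rewrite z0 mul0r => /esym/eqP.
    by rewrite mulf_eq0 invr_eq0 (negPf eps_neq0) orbF.
  by rewrite mulrACA yd -invfM zd invfM invrK mulrA divff // mul1r.
have tot : (\sum_d (nroots d + nroots (d / eps)) = \sum_(d : F) 2)%N.
  rewrite big_split /= sum_nroots -(reindex_inj (P := xpredT) (F := nroots) (mulIf _))
    ?invr_eq0 ?eps_neq0 //=.
  by rewrite sum_nroots sum_nat_const muln2 addnn.
apply/eqP; have := leqif_sum (fun d (_ : true) => leqif_eq (le2 d)).
by rewrite tot => -[_]; rewrite eqxx => /esym/forallP/(_ c).
Qed.

Lemma card_hyperbola (b : F) :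
  (\sum_(x : F) #|[set y | (x * y == b)%R]| = #|F| - 1 + #|F| * (b == 0%R))%N.
Proof.
rewrite (bigD1 0) //= addnC; congr (_ + _)%N.
  rewrite (eq_bigr (fun=> 1%N)) => [|x x0]; last first.
    rewrite (eq_card (B := pred1 (x^-1 * b))) ?card1 // => y; rewrite !inE.
    by apply/eqP/eqP => [<-|->]; rewrite ?mulKf ?mulVKf.
  rewrite sum1_card (eq_card (B := predC1 0)) ?cardC1 ?subn1 // => x.
have [->|b0] := eqVneq b 0.
  by rewrite muln1; apply: eq_card => y; rewrite !inE mul0r eqxx.
by rewrite muln0; apply: eq_card0 => y; rewrite !inE mul0r eq_sym (negPf b0).
Qed.

(* Factor z^2 - x^2 to reduce to a hyperbola. *)
Lemma sum_nroots_shift (b : F) :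
  (\sum_(x : F) nroots (x ^+ 2 - b)%R = #|F| - 1 + #|F| * (b == 0%R))%N.
Proof.
rewrite -card_hyperbola.
rewrite /nroots; under eq_bigr do rewrite -sum1_card.
under [RHS]eq_bigr do rewrite -sum1_card.
rewrite !pair_big_dep /=.
pose h (p : F * F) := (p.1 + p.2, p.1 - p.2).
pose g (p : F * F) := ((p.1 + p.2) / 2%:R, (p.1 - p.2) / 2%:R).
rewrite [RHS](reindex h) /=; last first.
  exists g => -[x y] _; rewrite /h /g /=; congr pair; field; exact: two_neq0.
apply: eq_bigl => -[x y]; rewrite !inE /=.
by apply/eqP/eqP => [yx|<-]; [rewrite -[RHS](subKr (x ^+ 2)) -yx|]; ring.
Qed.

(** Solving for y instead of x gives root counts of (x^2 - b) / eps. By [nroots_twist] they are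
    complementary to those of x^2 - b, which the hyperbola has settled. Adding the term for b = 0 on
    the left avoids a truncated subtraction. *)
Lemma card_norm_form (b : F) :
  (\sum_(y : F) nroots (b + eps * y ^+ 2)%R + #|F| * (b == 0%R) = #|F| + 1)%N.
Proof.
have -> : (\sum_(y : F) nroots (b + eps * y ^+ 2)%R =
           \sum_(x : F) nroots ((x ^+ 2 - b) / eps)%R)%N.
  rewrite /nroots; under eq_bigr do rewrite -sum1_card.
  under [RHS]eq_bigr do rewrite -sum1_card.
  rewrite !pair_big_dep /= [RHS](reindex (fun p => (p.2, p.1))) /=; last first.
    by exists (fun p => (p.2, p.1)) => -[].
  apply: eq_bigl => -[x y]; rewrite !inE /=.
  by apply/eqP/eqP => [->|yx]; [|rewrite yx]; field; exact: eps_neq0.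
have := sum_nroots_shift b.
have : (\sum_(x : F) (nroots (x ^+ 2 - b)%R + nroots ((x ^+ 2 - b) / eps)%R) = #|F| * 2)%N.
  by rewrite (eq_bigr _ (fun x _ => nroots_twist _)) sum_nat_const.
rewrite big_split /= => h1 h2.
have q0 : (0 < #|F|)%N by apply/card_gt0P; exists 0.
have arith Q X k : (0 < Q -> Q - 1 + k + X = Q * 2 -> X + k = Q + 1)%N by lia.
by apply: arith q0 _; rewrite -h2.
Qed.

(** The norm form takes the value 0 once and every other value q + 1 times. The minus sign reflects
    anisotropy: a hyperbolic plane would give + q. *)
Lemma sum_dev_norm (a b : F) : a != 0 ->
  \sum_x \sum_y dev (a * (x ^+ 2 - eps * y ^+ 2) + b) = - q * dev b.
Proof.
move=> a0; rewrite pair_bigA /=.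
rewrite (eq_bigr (fun p => dev (a * (p.1 ^+ 2 - eps * p.2 ^+ 2) - - b))); last by move=> p _;
  rewrite opprK.
rewrite sum_dev_fiber.
have := card_norm_form (- b / a).
have -> : (\sum_y nroots (- b / a + eps * y ^+ 2)%R =
   #|[set x : F * F | xpredT x & (a * (x.1 ^+ 2 - eps * x.2 ^+ 2) == - b)%R]|)%N.
  rewrite /nroots; under eq_bigr do rewrite -sum1_card.
  rewrite -sum1_card pair_big_dep /= [RHS](reindex (fun p => (p.2, p.1))) /=; last first.
    by exists (fun p => (p.2, p.1)) => -[].
  apply: eq_bigl => -[y x]; rewrite !inE /=.
  apply/eqP/eqP => [->|h]; first by field.
  by rewrite -h; field.
rewrite mulf_eq0 oppr_eq0 invr_eq0 (negPf a0) orbF => h.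
have {h} : (#|[set x : F * F | xpredT x & (a * (x.1 ^+ 2 - eps * x.2 ^+ 2) == - b)%R]|%:R + q *
  (b == 0)%:R
    = q + 1 :> rat) by rewrite -natrM -natrD h natrD.
rewrite /dev => /(canRL (addrK _)) ->.
have -> : #|{: F * F}| = (#|F| * #|F|)%N by rewrite card_prod.
by rewrite natrM; ring.
Qed.

(** Multiplication by a + b sqrt(eps) on the quadratic extension, in the basis 1, sqrt(eps);
    SO^-(2,q) is its group of norm 1 elements. *)
Definition rot2 (a b : F) : 'M[F]_2 :=
  \matrix_(i < 2, j < 2) (if i == j then a else if i == 0 then eps * b else b).

Lemma det2 (A : 'M[F]_2) : \det A = A 0 0 * A 1 1 - A 0 1 * A 1 0.
Proof.
rewrite (expand_det_row _ 0) !big_ord_recl big_ord0 addr0 /cofactor !det_mx11 !mxE.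
have e10 : lift 0 0 = 1 :> 'I_2 by apply/val_inj.
have e01 : lift 1 0 = 0 :> 'I_2 by apply/val_inj.
by rewrite /= !e10 !e01 addn0 expr0 mul1r [bump _ _]/= expr1 mulN1r mulrN.
Qed.

Lemma eq_mx2 (A B : 'M[F]_2) :
  [/\ A 0 0 = B 0 0, A 0 1 = B 0 1, A 1 0 = B 1 0 & A 1 1 = B 1 1] -> A = B.
Proof.
case=> e00 e01 e10 e11; apply/matrixP=> i j.
have c (k : 'I_2) : k = 0 \/ k = 1.
  by case: k => [[|[|]]] //= hk; [left|right]; apply/val_inj.
by case: (c i) (c j) => -> [] ->.
Qed.

Lemma SOm2P (i : 'M[F]_2) :
  reflect (exists2 p : F * F, p.1 ^+ 2 - eps * p.2 ^+ 2 = 1 & i = rot2 p.1 p.2)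
    (i \in SOm2 eps).
Proof.
apply: (iffP idP) => [|[[a b] /= ab1 ->]].
  rewrite inE => /andP[/eqP/matrixP orth /eqP]; rewrite det2 => det1.
  have := orth 0 0; have := orth 0 1; have := orth 1 1.
  rewrite !mxE !big_ord_recl !big_ord0 !mxE !big_ord_recl !big_ord0 !mxE /=.
  have -> : lift ord0 ord0 = 1 :> 'I_2 by apply/val_inj.
  have -> : ord0 = 0 :> 'I_2 by apply/val_inj.
  rewrite !(mulr0, mulr1, add0r, addr0) => _ o01 o00.
  (* With determinant 1 the inverse is the adjugate, so orthogonality reads i^T delta = delta
     adj(i). Its first row gives this equation and the next; both are written as explicit
     combinations of the three scalar equations. *)
  have tE : i 1 1 = i 0 0.
    apply/eqP; rewrite -subr_eq0; apply/eqP.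
    transitivity (- i 1 1 * ((i 0 0 * i 0 0 + i 1 0 * - eps * i 1 0) - 1)
      + i 0 0 * ((i 0 0 * i 1 1 - i 0 1 * i 1 0) - 1)
      + i 1 0 * (i 0 0 * i 0 1 + i 1 0 * - eps * i 1 1)); first by ring.
    by rewrite o00 o01 det1; ring.
  have yE : i 0 1 = eps * i 1 0.
    apply/eqP; rewrite -subr_eq0; apply/eqP.
    transitivity (- i 0 1 * ((i 0 0 * i 0 0 + i 1 0 * - eps * i 1 0) - 1)
      + eps * i 1 0 * ((i 0 0 * i 1 1 - i 0 1 * i 1 0) - 1)
      + i 0 0 * (i 0 0 * i 0 1 + i 1 0 * - eps * i 1 1)); first by ring.
    by rewrite o00 o01 det1; ring.
  exists (i 0 0, i 1 0) => /=; first by rewrite -o00; ring.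
  by apply: eq_mx2; rewrite !mxE.
rewrite inE; apply/andP; split; apply/eqP; last by rewrite det2 !mxE /= -ab1; ring.
apply: eq_mx2; rewrite !mxE !big_ord_recl !big_ord0 !mxE !big_ord_recl !big_ord0 !mxE /=.
split; try ring.
  by rewrite -[RHS]ab1; ring.
by rewrite -[RHS]mulr1 -[X in _ = _ * X]ab1; ring.
Qed.

Lemma sum_SOm2 (V : nmodType) (phi : 'M[F]_2 -> V) :
  \sum_(i in SOm2 eps) phi i =
  \sum_(p : F * F | p.1 ^+ 2 - eps * p.2 ^+ 2 == 1) phi (rot2 p.1 p.2).
Proof.
have rot_inj : injective (fun p : F * F => rot2 p.1 p.2).
  move=> [a b] [c d] /= /matrixP e; have := e 0 0; have := e 1 0.
  by rewrite !mxE /= => -> ->.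
rewrite -(big_imset phi (in2W rot_inj)) /=; apply: eq_bigl => i.
apply/SOm2P/imsetP => [[p p1 ->]|[p]]; first by exists p => //; apply/eqP.
by rewrite unfold_in /= => /eqP p1 ->; exists p.
Qed.

Lemma card_SOm2 : #|SOm2 eps| = (#|F| + 1)%N.
Proof.
rewrite -sum1_card sum_SOm2 -(card_norm_form 1) oner_eq0 muln0 addn0.
rewrite /nroots; under [RHS]eq_bigr do rewrite -sum1_card.
rewrite pair_big_dep /= [RHS](reindex (fun p => (p.2, p.1))) /=; last first.
  by exists (fun p => (p.2, p.1)) => -[].
by apply: eq_bigl => -[x y]; rewrite inE /= subr_eq.
Qed.

(** The diagonal pair is separated from the off-diagonal one because the trace sees only the former
    and the determinant sees only the product of the latter. *)
Lemma sum_mx2 (V : nmodType) (phi : F -> F -> F -> F -> V) :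
  \sum_(X : 'M[F]_2) phi (X 0 0) (X 1 1) (X 0 1) (X 1 0) =
  \sum_(ad : F * F) \sum_(bc : F * F) phi ad.1 ad.2 bc.1 bc.2.
Proof.
rewrite pair_bigA /=.
pose mk (u : (F * F) * (F * F)) : 'M[F]_2 := \matrix_(i, j)
  (if i == 0 then if j == 0 then u.1.1 else u.2.1 else if j == 0 then u.2.2 else u.1.2).
rewrite (reindex mk) /=; first by apply: eq_bigr => u _; rewrite !mxE.
exists (fun X => ((X 0 0, X 1 1), (X 0 1, X 1 0))) => [[[a d] [b c]] _|X _].
  by rewrite !mxE.
by apply: eq_mx2; rewrite !mxE.
Qed.

Lemma tr2 (X : 'M[F]_2) : \tr X = X 0 0 + X 1 1.
Proof.
rewrite /mxtrace !big_ord_recl big_ord0 addr0.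
by congr (_ + X _ _); apply/val_inj.
Qed.

(** The adjugate of a 2 by 2 matrix has the same trace as the matrix. *)
Lemma tr_invmx2 (X : 'M[F]_2) : X \in unitmx -> \tr (invmx X) = \tr X / \det X.
Proof.
move=> Xu; rewrite /invmx Xu mxtraceZ mulrC; congr (_ / _).
have e10 : lift 0 0 = 1 :> 'I_2 by apply/val_inj.
have e01 : lift 1 0 = 0 :> 'I_2 by apply/val_inj.
rewrite !tr2 !mxE /cofactor !det_mx11 !mxE !e10 !e01 /=.
by rewrite expr0 -signr_odd expr0 !mul1r addrC.
Qed.
End Squares.

(** * Trace distributions on the tori and on GL(2,q) in characteristic 3 *)

Section TraceCounts.
Variables (F : finFieldType) (char3 : 3%:R = 0 :> F).
Variables (eps : F) (epsN : ~~ issq eps).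
Local Notation q := (#|F|%:R : rat).

Lemma two_eqN1 : 2%:R = -1 :> F.
Proof. by apply/eqP; rewrite -subr_eq0 opprK natr1 char3. Qed.

Lemma two_neq0 : 2%:R != 0 :> F.
Proof. by rewrite two_eqN1 oppr_eq0 oner_eq0. Qed.

(** The trace of [rot2 a b] is 2 a = - a, so a = - c, and the norm equation leaves b^2 = (c^2 - 1) /
    eps. *)
Lemma card_SOm2_tr (c : F) :
  #|[set i in SOm2 eps | \tr i == c]| = nroots ((c ^+ 2 - 1) / eps).
Proof.
have e0 := eps_neq0 epsN.
rewrite -!sum1_card (eq_bigl (fun i => (i \in SOm2 eps) && (\tr i == c))); last by move=> i;
  rewrite inE.
rewrite big_mkcondr sum_SOm2 -big_mkcondr /=.
rewrite (eq_bigl (fun p : F * F => (p.1 == - c) && (p.2 ^+ 2 == (c ^+ 2 - 1) / eps))); last first.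
  move=> [a b] /=; rewrite tr2 !mxE /= -mulr2n -mulr_natl two_eqN1 mulN1r eqr_oppLR.
  have [->|_] := eqVneq a (- c); last by rewrite andbF.
  rewrite andbT sqrrN; apply/eqP/eqP => [<-|->]; field; exact: e0.
rewrite -(pair_big (pred1 (- c)) (fun b => b ^+ 2 == (c ^+ 2 - 1) / eps) (fun _ _ => 1%N)) /=.
by rewrite big_pred1_eq /nroots -[RHS]sum1_card; apply: eq_bigl => y; rewrite inE.
Qed.

(** Since 2 = -1, the shift y = a + c completes the square in a^2 - c a + 1 = 0 and turns it into
    y^2 = c^2 - 1. *)
Lemma card_recip (c : F) :
  #|[set a : F | (a != 0) && (a + a^-1 == c)]| = nroots (c ^+ 2 - 1).
Proof.
rewrite /nroots -(card_imset _ (addIr c)); apply: eq_card => y; rewrite [RHS]inE.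
apply/imsetP/eqP => [[a]|yc].
  rewrite inE => /andP[a0 /eqP <-] ->.
  have -> : (a + (a + a^-1)) ^+ 2 = (a + a^-1) ^+ 2 - 1 + 3%:R * (a ^+ 2 + 1) by field.
  by rewrite char3 mul0r addr0.
exists (y - c); last by rewrite subrK.
have y0 : y - c != 0.
  apply: contra_eq_neq yc => /eqP; rewrite subr_eq0 => /eqP->.
  by rewrite -subr_eq0 opprB addrCA subrr addr0 oner_eq0.
rewrite inE y0 /= -(inj_eq (mulIf y0)) mulrDl mulVf // -subr_eq0.
have -> : (y - c) * (y - c) + 1 - c * (y - c) = y ^+ 2 - (c ^+ 2 - 1) + 3%:R * (c ^+ 2 - y * c)
  by ring.
by rewrite yc subrr char3 mul0r addr0.
Qed.

Lemma sum_dev_SOm2 (b : F) :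
  \sum_(i in SOm2 eps) dev (\tr i - b) = q * (nroots ((b ^+ 2 - 1) / eps))%:R - (q + 1).
Proof. by rewrite sum_dev_fiber card_SOm2_tr (card_SOm2 two_neq0 epsN) natrD. Qed.

Lemma card_units : (#|predC1 (0 : F)|)%:R = q - 1.
Proof.
by rewrite cardC1 -subn1 natrB //; apply/card_gt0P; exists 0.
Qed.

Lemma sum_field_const (x : rat) : \sum_(a : F) x = q * x.
Proof. by rewrite sumr_const mulr_natl. Qed.

Lemma sum_units_const (x : rat) : \sum_(a : F | a != 0) x = (q - 1) * x.
Proof. by rewrite sumr_const -card_units mulr_natl. Qed.

Lemma sum_dev_recip (b : F) :
  \sum_(a : F | a != 0) dev (a + a^-1 - b) = q * (nroots (b ^+ 2 - 1))%:R - (q - 1).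
Proof. by rewrite sum_dev_fiber card_recip -card_units. Qed.

Lemma sum_nroots_recip (b : F) :
  (\sum_(a : F | a != 0%R) nroots ((b - a - a^-1) ^+ 2 - 1)%R = delta2 b)%N.
Proof.
under eq_bigr do rewrite -card_recip -sum1_card.
rewrite pair_big_dep /= /delta2 -sum1_card; apply: eq_bigl => -[x y].
rewrite !inE /=; congr [&& _, _ & _].
by rewrite -[LHS]subr_eq0 -[RHS]subr_eq0; congr (_ == 0); ring.
Qed.

(** By [nroots_twist] the norm 1 torus has the trace distribution complementary to that of the split
    torus. Hence this is the negative of [sum_dev_recip2], and [delta2] appears although the second
    variable is not split. *)
Lemma sum_dev_recip_SOm2 (b : F) :
  \sum_(a : F | a != 0) \sum_(i in SOm2 eps) dev (a + a^-1 + \tr i - b) =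
  (q - 1) ^+ 2 - q * (delta2 b)%:R.
Proof.
rewrite (eq_bigr (fun a => (2 * q - (q + 1)) - q * (nroots ((b - a - a^-1) ^+ 2 - 1))%:R)).
  by rewrite sumrB sum_units_const -mulr_sumr -natr_sum sum_nroots_recip; ring.
move=> a a0; rewrite (eq_bigr (fun i => dev (\tr i - (b - a - a^-1)))); last by move=> i _;
  congr dev; ring.
rewrite sum_dev_SOm2.
have := nroots_twist two_neq0 epsN ((b - a - a^-1) ^+ 2 - 1).
by move/(congr1 (GRing.natmul (1 : rat))); rewrite natrD => /(canRL (addKr _)) ->; ring.
Qed.

Lemma sum_dev_recip2 (b : F) :
  \sum_(a : F | a != 0) \sum_(d : F | d != 0) dev (a + a^-1 + d + d^-1 - b) =
  q * (delta2 b)%:R - (q - 1) ^+ 2.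
Proof.
rewrite (eq_bigr (fun a => q * (nroots ((b - a - a^-1) ^+ 2 - 1))%:R - (q - 1))).
  by rewrite sumrB sum_units_const -mulr_sumr -natr_sum sum_nroots_recip; ring.
move=> a a0; rewrite -sum_dev_recip; apply: eq_bigr => d _; congr dev; ring.
Qed.

Lemma sum_dev_affine (c b : F) :
  \sum_(a : F) \sum_(d : F) dev ((a + d) * c - b) = q ^+ 2 * dev b *+ (c == 0).
Proof.
have [->|c0] := eqVneq c 0.
  under eq_bigr do under eq_bigr do rewrite mulr0 sub0r devN.
  by rewrite mulr1n !sum_field_const; ring.
rewrite big1 // => a _.
pose g t d : F := d + t / c.
apply: (@sum_dev_linear _ _ _ (fun d => (a + d) * c) g) => [//|t x|t x]; rewrite /g;
  first by field.
by field.
Qed.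

Lemma card_hyperbola_pairs (b : F) :
  #|[pred p : F * F | p.1 * p.2 == b]|%:R = q - 1 + q * (b == 0)%:R.
Proof.
rewrite -natrM -card_units cardC1 -subn1 -natrD -card_hyperbola.
under eq_bigr do rewrite -sum1_card.
rewrite pair_big_dep /= -sum1_card; congr (_%:R).
by apply: eq_bigl => -[x y]; rewrite !inE.
Qed.

(** For X with diagonal a, d and determinant e the argument is (a + d)(1 + 1/e) - b, so the
    off-diagonal entries matter only through their product a d - e, which is taken by q - 1 pairs,
    or by 2 q - 1 if a d = e. *)
Lemma sum_dev_GL2 (b : F) :
  \sum_(X : 'M[F]_2 | X \in unitmx) dev (\tr X + \tr (invmx X) - b) =
  q * (q * (delta2 b)%:R - 2 * q ^+ 2 + 3 * q - 1 + (q ^+ 3 - q ^+ 2) * (b == 0)%:R).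
Proof.
pose phi (a d x y : F) := dev ((a + d) * (1 + (a * d - x * y)^-1) - b) *+ (a * d - x * y != 0).
have -> : \sum_(X : 'M[F]_2 | X \in unitmx) dev (\tr X + \tr (invmx X) - b) =
          \sum_(X : 'M[F]_2) phi (X 0 0) (X 1 1) (X 0 1) (X 1 0).
  rewrite big_mkcond; apply: eq_bigr => X _; rewrite /phi -det2 -tr2 unitmxE unitfE.
  case: ifP => [X0|//]; rewrite mulr1n tr_invmx2 ?unitmxE ?unitfE //.
  by rewrite mulrDr mulr1.
rewrite sum_mx2.
rewrite (eq_bigr (fun ad => \sum_(e : F | e != 0)
    dev ((ad.1 + ad.2) * (1 + e^-1) - b) * (q - 1 + q * (ad.1 * ad.2 - e == 0)%:R))); last first.
  move=> [a d] _ /=; rewrite (eq_bigr (fun e => \sum_(p : F * F | a * d - p.1 * p.2 == e) dev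
    ((a + d) * (1 + e^-1) - b))); last first.
    move=> e _; rewrite sumr_const -[RHS]mulr_natr -card_hyperbola_pairs; congr (_ * _%:R).
    apply: eq_card => p; rewrite !unfold_in /=.
    by rewrite -[LHS]subr_eq0 -[RHS]subr_eq0 -[RHS]oppr_eq0; congr (_ == 0); ring.
  rewrite (exchange_big_dep xpredT) //=; apply: eq_bigr => p _; rewrite /phi.
  rewrite big_mkcondl /= (big_pred1 (a * d - p.1 * p.2)) => [|e]; first by case: (_ != 0).
  by rewrite eq_sym.
rewrite exchange_big /=.
(* The constant part q - 1 of the pair count leaves an affine sum that survives only at e = -1. The
   extra q for a d = e forces d = e / a, and with e / a as second variable this is
   [sum_dev_recip2]. *)
rewrite (eq_bigr (fun e => (q - 1) * (q ^+ 2 * dev b *+ (1 + e^-1 == 0)) +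
   q * \sum_(a : F | a != 0) dev (a + a^-1 + (e / a) + (e / a)^-1 - b))).
  rewrite big_split /= -!mulr_sumr.
  have -> : \sum_(e : F | e != 0) (q ^+ 2 * dev b *+ (1 + e^-1 == 0)) = q ^+ 2 * dev b.
    rewrite (bigD1 (-1)) ?oppr_eq0 ?oner_eq0 //= invrN1 subrr eqxx big1 ?addr0 // => e /andP[e0
      eN].
    rewrite -(inj_eq (mulIf e0)) mulrDl mulVf // mul0r mul1r addr_eq0.
    by rewrite (negPf eN).
  rewrite exchange_big /= (eq_bigr (fun a => \sum_(d : F | d != 0) dev (a + a^-1 + d + d^-1 -
    b))).
    by rewrite sum_dev_recip2 /dev; case: (b == 0); ring.
  move=> a a0; rewrite (reindex_inj (mulIf a0)) /=.
  by apply: eq_big => e; [rewrite mulf_eq0 (negPf a0) orbF | rewrite mulfK].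
move=> e e0.
rewrite -(pair_bigA _ (fun a d => dev ((a + d) * (1 + e^-1) - b) * (q - 1 + q * (a * d - e ==
  0)%:R))) /=.
rewrite -sum_dev_affine mulr_sumr mulr_sumr [X in _ = _ + X]big_mkcond -big_split /=.
apply: eq_bigr => a _.
under eq_bigr do rewrite mulrDr.
rewrite big_split /= mulr_sumr; congr (_ + _); first by apply: eq_bigr => d _; rewrite mulrC.
have [->|a0] := eqVneq a 0.
  by rewrite big1 // => d _; rewrite mul0r sub0r oppr_eq0 (negPf e0) mulr0 mulr0.
rewrite (bigD1 (e / a)) //= [a * _]mulrC divfK // subrr eqxx mulr1 big1 ?addr0 => [|d da].
  by rewrite mulrC; congr (_ * dev _); field; rewrite e0 a0.
rewrite subr_eq0 (_ : (a * d == e) = false) ?mulr0 ?mulr0 //.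
by apply: contra_neqF da => /eqP <-; rewrite mulrC mulKf.
Qed.
End TraceCounts.

(** * Symmetric and alternating matrices *)

Section BlockSums.
Variables (F : finFieldType) (V : nmodType).

Lemma sum_row_mx m n1 n2 (phi : 'M[F]_(m, n1 + n2) -> V) :
  \sum_M phi M = \sum_A \sum_B phi (row_mx A B).
Proof.
rewrite pair_bigA /= (reindex (fun p => row_mx p.1 p.2)) //=.
exists (fun M => (lsubmx M, rsubmx M)) => [[A B] _|M _] /=; last exact: hsubmxK.
by rewrite row_mxKl row_mxKr.
Qed.

Lemma sum_col_mx m1 m2 n (phi : 'M[F]_(m1 + m2, n) -> V) :
  \sum_M phi M = \sum_A \sum_B phi (col_mx A B).
Proof.
rewrite pair_bigA /= (reindex (fun p => col_mx p.1 p.2)) //=.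
exists (fun M => (usubmx M, dsubmx M)) => [[A B] _|M _] /=; last exact: vsubmxK.
by rewrite col_mxKu col_mxKd.
Qed.

Lemma sum_block_mx m1 m2 n1 n2 (phi : 'M[F]_(m1 + m2, n1 + n2) -> V) :
  \sum_M phi M = \sum_A \sum_B \sum_C \sum_D phi (block_mx A B C D).
Proof.
rewrite sum_col_mx sum_row_mx; apply: eq_bigr => A _; apply: eq_bigr => B _.
by rewrite sum_row_mx.
Qed.

Lemma sum_mx11 (phi : 'M[F]_1 -> V) : \sum_M phi M = \sum_a phi a%:M.
Proof.
rewrite (reindex (fun a : F => a%:M)) //=.
exists (fun M => M 0 0) => [a _|M _]; first by rewrite mxE eqxx.
by rewrite -mx11_scalar.
Qed.

End BlockSums.

Section SymmetricMatrices.
Variable F : finFieldType.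
Hypothesis two_neq0 : 2%:R != 0 :> F.
Local Notation q := (#|F|%:R : rat).

(** The rank normal form makes v a nonzero scalar multiple of the first row of [row_ebase v]. *)
Lemma complete_row r (v : 'rV[F]_(1 + r)) : v != 0 ->
  exists2 P, P \in unitmx & row_mx 1%:M 0 *m P = v.
Proof.
move=> v0; have rk1 : \rank v = 1%N by rewrite rank_rV v0.
have := mulmx_ebase v; have := col_ebase_unit v; rewrite rk1.
rewrite [col_ebase v]mx11_scalar; set c := col_ebase v 0 0.
rewrite unitmxE det_scalar1 unitfE => c0 <-.
exists (c%:M *m row_ebase v).
  by rewrite unitmx_mul row_ebase_unit unitmxE det_scalar unitrX ?unitfE.
rewrite mulmxA -scalar_mxC; congr (_ *m _ *m _).
by apply/rowP=> j; rewrite !mxE; case: splitP => k ->; rewrite !mxE ?(ord1 k).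
Qed.

(** Polarisation: if every vector were isotropic, twice each entry of S would vanish. *)
Lemma sym_nonisotropic r (S : 'M[F]_r) : S^T = S -> S != 0 ->
  exists v : 'rV_r, v *m S *m v^T != 0.
Proof.
move=> Ssym S0; apply/existsP; apply: contraNT S0 => /existsPn Siso.
have iso (v : 'rV_r) : v *m S *m v^T = 0 by apply/eqP; move: (Siso v); rewrite negbK.
apply/eqP/row_matrixP=> i; rewrite row0 rowE; apply: trmx_inj; rewrite trmx0.
apply/row_matrixP=> j; rewrite row0 rowE.
set u := delta_mx 0 i; set v := delta_mx 0 j.
have := iso (u + v); rewrite linearD /= !(mulmxDl, mulmxDr) !iso add0r addr0.
have -> : v *m S *m u^T = (u *m S *m v^T)^T by rewrite !trmx_mul trmxK Ssym mulmxA.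
have tr1 (M : 'M[F]_1) : M^T = M by rewrite [M]mx11_scalar tr_scalar_mx.
rewrite tr1 -mulr2n -scaler_nat => /eqP; rewrite scaler_eq0 (negPf two_neq0) /=.
by move=> /eqP h; rewrite -[LHS]tr1 trmx_mul trmxK.
Qed.

Lemma tr_block_sym r (S : 'M[F]_(1 + r)) : S^T = S ->
  exists a u S', S = block_mx a%:M u u^T S' /\ S'^T = S'.
Proof.
rewrite -[S]submxK tr_block_mx => /eq_block_mx[_ _ e2 e3].
by exists (ulsubmx S 0 0), (ursubmx S), (drsubmx S); rewrite -mx11_scalar e2.
Qed.

Lemma schur_complement r (a : F) (u : 'rV_r) (S : 'M_r) : a != 0 ->
  block_mx 1%:M 0 (- a^-1 *: u^T) 1%:M *m block_mx a%:M u u^T S *m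
    (block_mx 1%:M 0 (- a^-1 *: u^T) 1%:M)^T =
  block_mx a%:M 0 0 (S - a^-1 *: (u^T *m u)).
Proof.
move=> a0; rewrite tr_block_mx !mulmx_block !trmx0 !trmx1 !linearZ /= trmxK.
rewrite !(mul1mx, mulmx1, mul0mx, mulmx0, addr0, add0r).
rewrite !mul_mx_scalar mul_scalar_mx !scalerA mulNr mulrN mulVf // mulfV //.
rewrite !scaleN1r !addNr mul0mx scaler0 add0r -scalemxAl scaleNr scalerN.
by rewrite [X in block_mx _ _ _ X]addrC.
Qed.

Lemma unitmx_conj r (P S : 'M[F]_r) : P \in unitmx ->
  (P *m S *m P^T \in unitmx) = (S \in unitmx).
Proof. by move=> Pu; rewrite !unitmx_mul unitmx_tr Pu andbT. Qed.

Lemma unitmx_diag_block r (a : F) (S : 'M_r) : a != 0 ->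
  (block_mx (a%:M : 'M_1) 0 0 S \in unitmx) = (S \in unitmx).
Proof.
by move=> a0; rewrite !unitmxE det_ublock det_scalar1 unitrM unitfE a0.
Qed.

Lemma unit_lblock1 r (v : 'cV[F]_r) : block_mx (1%:M : 'M_1) 0 v 1%:M \in unitmx.
Proof. by rewrite unitmxE det_lblock !det1 mulr1 unitr1. Qed.

(** Take a non-isotropic vector as first row of P, so that the corner a is nonzero, and clear its
    row and column by a Schur complement. *)
Lemma sym_split r (S : 'M[F]_(1 + r)) : S^T = S -> S \in unitmx ->
  exists P a S', [/\ P \in unitmx, a != 0, S'^T = S', S' \in unitmx &
    P *m S *m P^T = block_mx a%:M 0 0 S'].
Proof.
move=> Ssym Su; have S0 : S != 0 by apply: contraTneq Su => ->; rewrite unitr0.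
have [v vS0] := sym_nonisotropic Ssym S0.
have v0 : v != 0 by apply: contraNneq vS0 => ->; rewrite !mul0mx.
have [P Pu Pv] := complete_row v0.
have PSsym : (P *m S *m P^T)^T = P *m S *m P^T by rewrite !trmx_mul trmxK Ssym mulmxA.
have [a [u [S1 [PSE S1sym]]]] := tr_block_sym PSsym.
have a0 : a != 0.
  apply: contraNneq vS0 => a0.
  have -> : v *m S *m v^T = row_mx 1%:M 0 *m (P *m S *m P^T) *m (row_mx 1%:M 0)^T.
    by rewrite -Pv trmx_mul !mulmxA.
  rewrite PSE tr_row_mx mul_row_block mul_row_col.
  by rewrite !(mul1mx, mul0mx, trmx1, trmx0, mulmx1, mulmx0, addr0) a0 -scalemx1 scale0r.
pose L := block_mx (1%:M : 'M[F]_1) 0 (- a^-1 *: u^T) 1%:M.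
have Lu : L \in unitmx by exact: unit_lblock1.
exists (L *m P), a, (S1 - a^-1 *: (u^T *m u)).
have E : (L *m P) *m S *m (L *m P)^T = block_mx a%:M 0 0 (S1 - a^-1 *: (u^T *m u)).
  by rewrite -schur_complement // trmx_mul -PSE !mulmxA.
split=> //; first by rewrite unitmx_mul Lu.
  by rewrite linearB linearZ /= trmx_mul trmxK S1sym.
by rewrite -(unitmx_diag_block _ a0) -E unitmx_conj // unitmx_mul Lu.
Qed.

Variables (eps : F) (epsN : ~~ issq eps).

(* Split off one variable of S at a time; each contributes a scaled norm form. *)
Lemma sum_dev_form r (S : 'M[F]_r) (b : F) : S^T = S -> S \in unitmx ->
  \sum_(h : 'M[F]_(2, r)) dev (\tr (deltaeps eps *m h *m S *m h^T) + b) =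
  (- q) ^+ r * dev b.
Proof.
elim: r S b => [|r IHr] S b Ssym Su.
  rewrite (big_pred1 0) => [|h]; last by rewrite /= [h]thinmx0 eqxx.
  by rewrite mulmx0 !mul0mx linear0 add0r mul1r.
have [P [a [S' [Pu a0 S'sym S'u PSP]]]] := sym_split (S := S : 'M_(1 + r)) Ssym Su.
rewrite (reindex (fun h => h *m P)) /=; last first.
  by exists (fun h => h *m invmx P) => h _; rewrite ?mulmxK ?mulmxKV.
rewrite (eq_bigr (fun h : 'M_(2, 1 + r) => dev (\tr (deltaeps eps *m h *m block_mx a%:M 0 0 S'
  *m h^T) + b))); last first.
  by move=> h _; rewrite -PSP trmx_mul !mulmxA.
rewrite sum_row_mx /=.
rewrite (eq_bigr (fun c : 'cV_2 => (- q) ^+ r * dev (a * (c 0 0 ^+ 2 - eps * c 1 0 ^+ 2) + b))).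
  rewrite -mulr_sumr exprSr -mulrA -(sum_dev_norm two_neq0 epsN _ a0); congr (_ * _).
  rewrite (sum_col_mx (m1 := 1) (m2 := 1)) sum_mx11; apply: eq_bigr => x _.
  rewrite sum_mx11; apply: eq_bigr => y _.
  have e0 : col_mx (x%:M : 'M_1) (y%:M : 'M_1) 0 0 = x.
    by rewrite mxE; case: splitP => k //; rewrite ord1 mxE.
  have e1 : col_mx (x%:M : 'M_1) (y%:M : 'M_1) 1 0 = y.
    by rewrite mxE; case: splitP => k //; rewrite ord1 ?mxE.
  by rewrite e0 e1.
move=> c _; rewrite -(IHr S') //; apply: eq_bigr => h _; congr dev; rewrite addrA; congr (_ + b).
rewrite mul_mx_row tr_row_mx mul_row_block mul_row_col !mulmx0 add0r addr0 linearD /= addrC.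
congr (_ + _); rewrite mul_mx_scalar -scalemxAl linearZ /=; congr (_ * _).
rewrite tr2 !mxE !big_ord_recl !big_ord0 !mxE !big_ord_recl !big_ord0 !mxE /=.
have -> : lift ord0 ord0 = 1 :> 'I_2 by apply/val_inj.
have -> : ord0 = 0 :> 'I_2 by [].
have -> : ord0 = 0 :> 'I_1 by [].
ring.
Qed.
End SymmetricMatrices.

(** * Numbers of nonsingular symmetric and of alternating matrices *)

Section Counts.
Variable F : finFieldType.
Hypothesis two_neq0 : 2%:R != 0 :> F.
Local Notation q := #|F|.

Definition nsym r := #|[set S : 'M[F]_r | (S^T == S) && (S \in unitmx)]|.

Lemma nsymE r : nsym r = (\sum_(S : 'M[F]_r) ((S^T == S) && (S \in unitmx)))%N.
Proof. by rewrite /nsym -sum1dep_card big_mkcond; apply: eq_bigr => S _; case: ifP. Qed.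

Lemma nsym0 : nsym 0 = 1%N.
Proof.
rewrite nsymE (big_pred1 0) => [|S]; last by rewrite /= [S]thinmx0 eqxx.
by rewrite trmx0 eqxx unitmxE det_mx00 unitr1.
Qed.

Lemma nsym_block r : nsym (1 + r) = (\sum_(a : F) \sum_(u : 'rV[F]_r) \sum_(S : 'M_r)
  ((S^T == S) && (block_mx a%:M u u^T S \in unitmx)))%N.
Proof.
rewrite nsymE sum_block_mx sum_mx11; apply: eq_bigr => a _; apply: eq_bigr => u _.
rewrite (bigD1 (u^T)) //= [X in (_ + X)%N = _]big1 ?addn0 => [|v vu].
  apply: eq_bigr => S _; rewrite tr_block_mx tr_scalar_mx trmxK.
  congr (nat_of_bool (_ && _)); apply/eqP/eqP => [/eq_block_mx[]//|->//].
apply: big1 => S _; rewrite tr_block_mx; case: eqP => // /eq_block_mx[_ _ uv].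
by rewrite uv eqxx in vu.
Qed.

Lemma unitmx_kerP r (A : 'M[F]_r) :
  reflect (forall v : 'rV_r, v *m A = 0 -> v = 0) (A \in unitmx).
Proof.
rewrite -row_free_unit -kermx_eq0; apply: (iffP rowV0P) => h v.
  by move=> /sub_kermxP; apply: h.
by move=> /sub_kermxP; apply: h.
Qed.

(** Passing to the Schur complement translates S by a fixed symmetric matrix, a bijection of the
    symmetric matrices. *)
Lemma nsym_schur r (a : F) (u : 'rV[F]_r) : a != 0 ->
  (\sum_(S : 'M_r) ((S^T == S) && (block_mx a%:M u u^T S \in unitmx)) = nsym r)%N.
Proof.
move=> a0; rewrite nsymE (reindex_inj (addIr (a^-1 *: (u^T *m u)))) /=.
apply: eq_bigr => S _; congr (nat_of_bool (_ && _)).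
  by rewrite linearD linearZ /= trmx_mul trmxK (inj_eq (addIr _)).
rewrite -(unitmx_conj _ (unit_lblock1 (- a^-1 *: u^T))) schur_complement //.
by rewrite unitmx_diag_block // addrK.
Qed.

Lemma nsym_bordered0 r :
  (\sum_(S : 'M[F]_r) ((S^T == S) && (block_mx (0%:M : 'M_1) 0 0^T S \in unitmx)) = 0)%N.
Proof.
apply: big1 => S _; rewrite andbC unitmxE trmx0 det_ublock det_scalar1 mul0r unitr0.
by [].
Qed.

(** The corner with rows (0, 1) and (1, b) is invertible for every b, and the zeros beside its first
    row make b and c irrelevant to the kernel. *)
Lemma unitmx_corner r (b : 'M[F]_1) (c : 'rV_r) (S : 'M_r) :
  (block_mx (0%:M : 'M_1) (row_mx 1%:M 0) (row_mx 1%:M 0)^T (block_mx b c c^T S) \in unitmx) =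
  (S \in unitmx).
Proof.
have eqn (x y : 'M[F]_1) (z : 'rV_r) :
  row_mx x (row_mx y z) *m block_mx (0%:M : 'M_1) (row_mx 1%:M 0) (row_mx 1%:M 0)^T (block_mx b
    c c^T S) =
  row_mx y (row_mx (x + (y *m b + z *m c^T)) (y *m c + z *m S)).
  rewrite mul_row_block tr_row_mx !mul_row_block !mul_mx_row !mul_row_col add_row_mx.
  by rewrite trmx1 trmx0 !mulmx1 !mulmx0 -scalemx1 scale0r mulmx0 !add0r addr0.
apply/unitmx_kerP/unitmx_kerP => ker v.
  move=> vS; have := ker (row_mx (- (v *m c^T)) (row_mx 0 v)).
  rewrite eqn !mul0mx !add0r addNr vS row_mx0 row_mx0 => /(_ erefl)/eqP.
  by rewrite !row_mx_eq0 => /and3P[_ _ /eqP].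
rewrite -[v]hsubmxK -[rsubmx v]hsubmxK eqn => /eqP.
set x := lsubmx v; set y := lsubmx (rsubmx v); set z := rsubmx (rsubmx v).
rewrite !row_mx_eq0 => /and3P[/eqP y0 /eqP xz /eqP zS].
move: xz zS; rewrite y0 !mul0mx !add0r => xz /ker z0.
by move: xz; rewrite z0 mul0mx addr0 => ->; rewrite !row_mx0.
Qed.

(** A congruence moves u to the first unit vector. Then [unitmx_corner] leaves the corner b (q
    choices) and the row c (q^r choices) free. *)
Lemma nsym_bordered r (u : 'rV[F]_(1 + r)) : u != 0 ->
  (\sum_(S : 'M_(1 + r)) ((S^T == S) && (block_mx (0%:M : 'M_1) u u^T S \in unitmx)) =
   q * q ^ r * nsym r)%N.
Proof.
move=> u0; have [P Pu Pv] := complete_row u0.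
pose Q := block_mx (1%:M : 'M[F]_1) 0 0 P^T.
have Qu : Q \in unitmx by rewrite unitmx_diag_block ?oner_eq0 // unitmx_tr.
rewrite (reindex (fun S => P^T *m S *m P)) /=; last first.
  exists (fun S => (invmx P)^T *m S *m invmx P) => S _.
    by rewrite !mulmxA -trmx_mul mulmxV // trmx1 mul1mx mulmxK.
  by rewrite !mulmxA -trmx_mul mulVmx // trmx1 mul1mx mulmxKV.
rewrite (eq_bigr (fun S : 'M_(1 + r) => nat_of_bool ((S^T == S) &&
  (block_mx (0%:M : 'M_1) (row_mx 1%:M 0) (row_mx 1%:M 0)^T S \in unitmx)))); last first.
  move=> S _; congr (nat_of_bool (_ && _)).
    rewrite !trmx_mul trmxK mulmxA (inj_eq (can_inj (mulmxK Pu))).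
    have PTu : P^T \in unitmx by rewrite unitmx_tr.
    by rewrite (inj_eq (can_inj (mulKmx PTu))).
  rewrite -[RHS](unitmx_conj _ Qu) -Pv /Q tr_block_mx !mulmx_block !trmx0 !trmx1 trmxK.
  rewrite !(mul1mx, mulmx1, mul0mx, mulmx0, addr0, add0r).
  by rewrite trmx_mul.
rewrite sum_block_mx.
rewrite (eq_bigr (fun _ => q ^ r * nsym r))%N; last first.
  move=> b _; rewrite (eq_bigr (fun _ => nsym r)); last first.
    move=> c _; rewrite nsymE (bigD1 (c^T)) //= [X in (_ + X)%N = _]big1 ?addn0 => [|v vc].
      apply: eq_bigr => S _; rewrite unitmx_corner; congr (nat_of_bool (_ && _)).
      rewrite tr_block_mx trmxK [b]mx11_scalar tr_scalar_mx.
      by apply/eqP/eqP => [/eq_block_mx[]//|->//].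
    apply: big1 => S _; rewrite tr_block_mx; case: eqP => // /eq_block_mx[_ _ uv].
    by rewrite uv eqxx in vc.
  by rewrite sum_nat_const card_mx mul1n.
by rewrite sum_nat_const card_mx mul1n expn1 mulnA.
Qed.

Lemma nsym1 : nsym 1 = (q - 1)%N.
Proof.
rewrite (nsym_block 0) (bigD1 0) //= [X in (X + _)%N = _]big1 ?add0n => [|u _].
  rewrite (eq_bigr (fun _ => 1%N)) => [|a a0].
    by rewrite sum1_card cardC1 subn1.
  rewrite (big_pred1 0) => [|u]; last by rewrite /= [u]thinmx0 eqxx.
  by rewrite nsym_schur // nsym0.
by rewrite [u]thinmx0 nsym_bordered0.
Qed.

(** Sort by the first row (a, u): a nonzero leaves a Schur complement of size r + 1; a = 0 with u
    nonzero splits off a 2 by 2 corner and leaves size r; a zero row gives nothing. *)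
Lemma nsym_rec r :
  nsym r.+2 = ((q - 1) * q ^ r.+1 * nsym r.+1 + (q ^ r.+1 - 1) * q ^ r.+1 * nsym r)%N.
Proof.
rewrite (nsym_block r.+1) (bigD1 0) //= addnC; congr (_ + _)%N.
  rewrite (eq_bigr (fun _ => q ^ r.+1 * nsym r.+1))%N => [|a a0].
    by rewrite sum_nat_const cardC1 subn1 mulnA.
  rewrite (eq_bigr (fun _ => nsym r.+1)) => [|u _]; last exact: nsym_schur.
  by rewrite sum_nat_const card_mx mul1n.
rewrite (bigD1 0) //= nsym_bordered0 add0n.
rewrite (eq_bigr (fun _ => q * q ^ r * nsym r))%N => [|u u0];
  last exact: (nsym_bordered (r := r)).
by rewrite sum_nat_const cardC1 card_mx mul1n -subn1 expnS mulnA.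
Qed.

Lemma card_unitmx n :
  #|[set A : 'M[F]_n | A \in unitmx]| = (q ^ 'C(n, 2) * \prod_(1 <= i < n.+1) (q ^ i - 1))%N.
Proof.
case: n => [|n].
  rewrite big_geq // muln1 (eq_card (B := pred1 0)) ?card1 // => A.
  by rewrite !inE [A]thinmx0 unitmxE det_mx00 unitr1 eqxx.
rewrite -card_GL // cardsT card_sub; apply: eq_card => A.
by rewrite !inE.
Qed.

(** As 2 is invertible, the diagonal of such a matrix vanishes and these are the alternating
    matrices. *)
Definition nalt m := #|[set C : 'M[F]_m | C^T == - C]|.

Lemma naltE m : nalt m = (\sum_(C : 'M[F]_m) (C^T == - C))%N.
Proof. by rewrite /nalt -sum1dep_card big_mkcond; apply: eq_bigr => S _; case: ifP. Qed.

Lemma nalt_rec m : nalt (1 + m) = (q ^ m * nalt m)%N.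
Proof.
rewrite naltE sum_block_mx sum_mx11 (bigD1 0) //=.
rewrite [X in (_ + X)%N = _]big1 ?addn0 => [|a a0].
  rewrite (eq_bigr (fun _ => nalt m)); first by rewrite sum_nat_const card_mx mul1n.
  move=> u _; rewrite (bigD1 (- u^T)) //= [X in (_ + X)%N = _]big1 ?addn0 => [|v vu].
    rewrite naltE; apply: eq_bigr => S _; rewrite tr_block_mx opp_block_mx.
    rewrite tr_scalar_mx linearN /= trmxK opprK -scalemx1 scale0r oppr0; congr nat_of_bool.
    by apply/eqP/eqP => [/eq_block_mx[]//|->//].
  apply: big1 => S _; rewrite tr_block_mx opp_block_mx; case: eqP => // /eq_block_mx[_ _ uv _].
  by rewrite uv opprK eqxx in vu.
apply: big1 => u _; apply: big1 => v _; apply: big1 => S _.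
rewrite tr_block_mx opp_block_mx; case: eqP => // /eq_block_mx[/matrixP/(_ 0 0) aE _ _ _].
move: aE; rewrite !mxE eqxx mulr1n => /eqP; rewrite -addr_eq0 -mulr2n -mulr_natl.
by rewrite mulf_eq0 (negPf two_neq0) (negPf a0).
Qed.

Lemma card_alt m : nalt m = (q ^ 'C(m, 2))%N.
Proof.
elim: m => [|m IHm]; last by rewrite (nalt_rec m) IHm -expnD binS bin1 addnC.
rewrite naltE (big_pred1 0) => [|S]; last by rewrite /= [S]thinmx0 eqxx.
by rewrite [_^T]thinmx0 oppr0 eqxx.
Qed.
End Counts.

(** * Traces on a double coset *)

Section DoubleCoset.
Variables (F : finFieldType) (d : nat) (Q : {set 'M[F]_d}) (s : 'M[F]_d).
Hypotheses (Q1 : 1%:M \in Q) (Qunit : {in Q, forall w, w \in unitmx})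
  (QM : {in Q &, forall v w, v *m w \in Q}) (ss : s *m s = 1%:M).

(** Since s is an involution this is the intersection of Q with s Q s; its order is the fibre size
    of (a, b) |-> a s b. *)
Definition conj_stab := [set w in Q | s *m w *m s \in Q].
Definition dbl_coset := [set (a *m s) *m b | a in Q, b in Q].

(** A finite monoid of invertible matrices is a group: left multiplication by w is injective on Q,
    hence reaches the identity. *)
Lemma invmx_closed w : w \in Q -> invmx w \in Q.
Proof.
move=> wQ; have wu := Qunit wQ.
have inj : injective (mulmx w : 'M_d -> 'M_d) := can_inj (mulKmx wu).
have /setP/(_ 1%:M) : [set w *m x | x in Q] = Q.
  apply/eqP; rewrite eqEcard card_imset // leqnn andbT.
  by apply/subsetP=> _ /imsetP[x xQ ->]; apply: QM.
rewrite Q1 => /imsetP[x xQ wx].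
by rewrite -[invmx w]mulmx1 wx mulKmx.
Qed.

Lemma sum_dbl_coset (phi : 'M[F]_d -> rat) :
  \sum_(a in Q) \sum_(b in Q) phi (a *m s *m b) =
  #|conj_stab|%:R * \sum_(g in dbl_coset) phi g.
Proof.
rewrite pair_big /= (partition_big (fun p => p.1 *m s *m p.2) (mem dbl_coset)) /=; last first.
  by move=> [a b] /andP[/= aQ bQ]; apply/imset2P; exists a b.
rewrite mulr_sumr; apply: eq_bigr => _ /imset2P[a0 b0 a0Q b0Q ->].
rewrite (eq_bigr (fun _ => phi (a0 *m s *m b0))) => [|p /andP[_ /eqP->]//].
rewrite sumr_const mulr_natl; congr (_ *+ _).
have [a0u b0u] := (Qunit a0Q, Qunit b0Q).
(* The fibre through (a0, b0): w is inserted on the right of s and cancelled by its conjugate on the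
   left. *)
pose f w := (a0 *m invmx (s *m w *m s), w *m b0).
have f_inj : injective f by move=> v w [_ /(can_inj (mulmxK b0u))].
rewrite -(card_imset _ f_inj); apply: eq_card => -[a b]; rewrite unfold_in /=.
apply/idP/imsetP => [/andP[/andP[aQ bQ] /eqP eqg] | [w]].
  have [au bu] := (Qunit aQ, Qunit bQ).
  have E : s *m (b *m invmx b0) *m s = invmx a *m a0.
    apply: (can_inj (mulKmx au)); rewrite mulKVmx // !mulmxA eqg.
    by rewrite -[_ *m invmx b0]mulmxA mulmxV // mulmx1 -mulmxA ss mulmx1.
  have yQ : invmx a *m a0 \in Q by rewrite QM // invmx_closed.
  exists (b *m invmx b0); first by rewrite inE E yQ QM // invmx_closed.
  rewrite /f mulmxKV // E; congr pair.
  by rewrite -{1}[a0](mulKVmx au) mulmxK // Qunit.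
rewrite inE => /andP[wQ yQ] [-> ->]; rewrite !QM ?invmx_closed //=.
have sw : s *m w = s *m w *m s *m s by rewrite -[RHS]mulmxA ss mulmx1.
set y := s *m w *m s in yQ sw *.
by rewrite mulmxA -[_ *m s *m w]mulmxA sw mulmxA mulmxKV ?eqxx // Qunit.
Qed.

Lemma card_dbl_coset : (#|Q| * #|Q| = #|conj_stab| * #|dbl_coset|)%N.
Proof.
have := sum_dbl_coset (fun=> 1); rewrite !sumr_const -mulrnA -natrM => /eqP.
by rewrite eqr_nat => /eqP.
Qed.

(** Cyclic invariance gives tr(t a s y) = tr(t (t y t) a s), and t y t in Q is absorbed into a, so
    every y contributes the same. The cases t = 1 and t = rho serve the cosets without and with
    rho. *)
Lemma sum_dev_dbl_coset (t : 'M[F]_d) (b : F) :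
  t *m t = 1%:M -> {in Q, forall w, t *m w *m t \in Q} ->
  #|conj_stab|%:R * \sum_(g in dbl_coset) dev (\tr (t *m g) - b) =
  #|Q|%:R * \sum_(w in Q) dev (\tr (t *m (w *m s)) - b).
Proof.
move=> tt tQt; rewrite -(sum_dbl_coset (fun g => dev (\tr (t *m g) - b))) exchange_big /=.
rewrite mulr_natl -sumr_const; apply: eq_bigr => y yQ.
have tyQ := tQt _ yQ; have tyu := Qunit tyQ.
rewrite [RHS](reindex (fun a => t *m y *m t *m a)) /=; last first.
  exists (mulmx (invmx (t *m y *m t))) => a _; first by rewrite mulKmx.
  by rewrite mulKVmx.
apply: eq_big => [a|a _].
  apply/idP/idP => [aQ|]; first exact: QM.
  by move=> /(QM (invmx_closed tyQ)); rewrite mulKmx.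
congr (dev (_ - b)).
by rewrite mulmxA mxtrace_mulC !mulmxA tt mul1mx.
Qed.
End DoubleCoset.

(** * The parabolic subgroup *)

Ltac mxb := do ?[rewrite !(mul1mx, mulmx1, mul0mx, mulmx0, addr0, add0r,
  trmx0, trmx1, oppr0, @row_mx0, @col_mx0, @block_mx0, tr_block_mx, tr_col_mx, tr_row_mx,
  mulmx_block, mul_block_col, mul_row_block, mul_col_row, mul_row_col,
  mul_col_mx, mul_mx_row, add_block_mx, add_col_mx, add_row_mx)].

Section Parabolic.
Variables (F : finFieldType) (eps : F) (epsN : ~~ issq eps) (m : nat).
Local Notation d := (m + m + 2)%N.
Local Notation delta := (deltaeps eps).
Local Notation Q := (Qgrp m.+1 eps).

Definition Jform : 'M[F]_d := block_mx (block_mx 0 1%:M 1%:M 0) 0 0 delta.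

Definition qmx (A : 'M[F]_m) (i : 'M[F]_2) (B : 'M[F]_m) (h : 'M[F]_(2, m)) : 'M[F]_d :=
  block_mx (block_mx A (A *m B) 0 (invmx A)^T) (col_mx (- (A *m h^T *m delta)) 0)
           (row_mx 0 (i *m h)) i.

Lemma levi_unip A i B h : levi (n := m.+1) A i *m unip eps B h = qmx A i B h.
Proof.
by rewrite /levi /unip /qmx /=; mxb; rewrite mulmxN mulmxA.
Qed.

Definition qpar (A : 'M[F]_m) (i : 'M[F]_2) (B : 'M[F]_m) (h : 'M[F]_(2, m)) :=
  [&& A \in unitmx, i \in SOm2 eps & B^T + B + h^T *m delta *m h == 0].

Lemma QgrpP w : reflect (exists A i B h, qpar A i B h /\ w = qmx A i B h) (w \in Q).
Proof.
rewrite inE; apply: (iffP existsP) => [[A /existsP[i /existsP[B /existsP[h]]]]|[A [i [B [h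
  []]]]]].
  case/and4P=> Au iS Bh /eqP ->; exists A, i, B, h; split; first exact/and3P.
  exact: levi_unip.
case/and3P=> Au iS Bh ->; exists A; apply/existsP; exists i; apply/existsP; exists B.
by apply/existsP; exists h; apply/and4P; split=> //; rewrite levi_unip.
Qed.

Lemma delta_unit : delta \in unitmx.
Proof.
rewrite unitmxE det2 !mxE /= mul0r subr0 mul1r unitfE oppr_eq0.
exact: eps_neq0 epsN.
Qed.

Lemma tr_delta : delta^T = delta.
Proof. by apply: eq_mx2; rewrite !mxE. Qed.

Lemma SOm2_orth i : i \in SOm2 eps -> i^T *m delta *m i = delta.
Proof. by rewrite inE => /andP[/eqP]. Qed.

Lemma SOm2_unit i : i \in SOm2 eps -> i \in unitmx.
Proof. by rewrite inE unitmxE => /andP[_ /eqP->]; rewrite unitr1. Qed.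

(* Q is the stabiliser in O(J) of the span of the first m basis vectors, cut
   down by the determinant condition. *)
Definition inQ (w : 'M[F]_d) := [&& w^T *m Jform *m w == Jform,
  dlsubmx (ulsubmx w) == 0, lsubmx (dlsubmx w) == 0 & \det (drsubmx w) == 1].

Lemma orthE A P D R T H (i : 'M[F]_2) :
  let w : 'M[F]_d := block_mx (block_mx A P 0 D) (col_mx R T) (row_mx 0 H) i in
  w^T *m Jform *m w = block_mx
    (block_mx 0 (A^T *m D) (D^T *m A) (P^T *m D + D^T *m P + H^T *m delta *m H))
    (col_mx (A^T *m T) (P^T *m T + D^T *m R + H^T *m delta *m i))
    (row_mx (T^T *m A) (T^T *m P + R^T *m D + i^T *m delta *m H))
    (T^T *m R + R^T *m T + i^T *m delta *m i).
Proof.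
rewrite /= /Jform; mxb.
have -> : row_mx 0 (col_mx 0 (H^T *m delta *m H)) = block_mx 0 0 0 (H^T *m delta *m H).
  by move=> n1 n2; rewrite block_mxEh col_mx0.
by mxb; rewrite [D^T *m P + _]addrC [D^T *m R + _]addrC.
Qed.

Lemma qmx_inQ A i B h : qpar A i B h -> inQ (qmx A i B h).
Proof.
case/and3P=> Au iS /eqP Bh; have io := SOm2_orth iS.
rewrite /inQ /qmx block_mxKul block_mxKdl block_mxKdl row_mxKl block_mxKdr !eqxx /=.
rewrite -/(qmx A i B h) andbC; move: iS; rewrite inE => /andP[_ ->] /=.
have AVA : A^T *m (invmx A)^T = 1%:M by rewrite -trmx_mul mulVmx ?trmx1.
apply/eqP; rewrite /qmx orthE /Jform trmxK AVA mulVmx //; mxb.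
have e1 : (A *m B)^T *m (invmx A)^T + invmx A *m (A *m B) + (i *m h)^T *m delta *m (i *m h) = 0.
  have -> : (A *m B)^T *m (invmx A)^T = B^T by rewrite trmx_mul -mulmxA AVA mulmx1.
  rewrite mulKmx // -[RHS]Bh; congr (_ + _).
  by rewrite trmx_mul -!mulmxA; congr (_ *m _); rewrite !mulmxA io.
have e2 : invmx A *m - (A *m h^T *m delta) + (i *m h)^T *m delta *m i = 0.
  rewrite mulmxN -mulmxA mulKmx // trmx_mul -2!mulmxA [i^T *m _]mulmxA io.
  by rewrite addNr.
have e3 : (- (A *m h^T *m delta))^T *m (invmx A)^T + i^T *m delta *m (i *m h) = 0.
  rewrite linearN /= !trmx_mul trmxK tr_delta mulNmx -!mulmxA AVA mulmx1.
  by rewrite [i^T *m _]mulmxA [_ *m (i *m h)]mulmxA io addNr.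
by rewrite e1 e2 e3 io; mxb.
Qed.

(** Orthogonality forces T = 0 and D = (A^-1)^T and determines R from A, H and i. What remains is
    the condition on B = A^-1 P and h = i^-1 H, together with the orthogonality of i. *)
Lemma inQ_Qgrp w : inQ w -> w \in Q.
Proof.
rewrite -[w]submxK -[ulsubmx w]submxK -[ursubmx w]vsubmxK -[dlsubmx w]hsubmxK /inQ.
set A := ulsubmx _; set P := ursubmx _; set C := dlsubmx _; set D := drsubmx _.
set R := usubmx _; set T := dsubmx _; set G := lsubmx _; set H := rsubmx _; set i := drsubmx w.
rewrite block_mxKul block_mxKdl block_mxKdl row_mxKl block_mxKdr.
case/and4P=> orth /eqP C0 /eqP G0 deti; move: orth; rewrite C0 G0 => /eqP.
rewrite orthE /Jform => /eq_block_mx[/eq_block_mx[_ AD _ PD] /eqP + _ io].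
rewrite col_mx_eq0 => /andP[/eqP AT /eqP DR].
have [ATu Du] := mulmx1_unit AD; have Au : A \in unitmx by rewrite -unitmx_tr.
have T0 : T = 0 by rewrite -[T](mulKmx ATu) AT mulmx0.
have DE : D = (invmx A)^T by rewrite -[D](mulKmx ATu) AD mulmx1 trmx_inv.
move: DR io; rewrite T0; mxb => DR io.
have iS : i \in SOm2 eps by rewrite inE deti io eqxx.
have iu := SOm2_unit iS.
have DTA : D^T = invmx A by rewrite DE trmxK.
apply/QgrpP; exists A, i, (invmx A *m P), (invmx i *m H); split.
  apply/and3P; split=> //; apply/eqP; rewrite -PD DTA DE trmx_mul; congr (_ + _).
  by rewrite trmx_mul trmx_inv -{1}io -!mulmxA mulKVmx // mulKmx ?unitmx_tr.
rewrite /qmx !mulKVmx // DE; congr (block_mx _ (col_mx _ _) _ _).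
rewrite trmx_mul -mulmxA -mulmxA.
have -> : (invmx i)^T *m delta = delta *m i.
  by rewrite trmx_inv -{1}io -mulmxA mulKmx ?unitmx_tr.
apply: (can_inj (mulKmx (_ : invmx A \in unitmx))); first by rewrite unitmx_inv.
rewrite mulmxN mulKmx // -DTA; apply/eqP; rewrite -addr_eq0; apply/eqP.
by rewrite -[RHS]DR !mulmxA.
Qed.

Lemma QgrpE w : (w \in Q) = inQ w.
Proof.
apply/idP/idP => [/QgrpP[A [i [B [h [qp ->]]]]]|]; [exact: qmx_inQ | exact: inQ_Qgrp].
Qed.

Lemma Jform_unit : Jform \in unitmx.
Proof.
rewrite unitmxE det_ublock unitrM -!unitmxE delta_unit andbT.
have : block_mx 0 1%:M 1%:M 0 *m block_mx 0 1%:M 1%:M 0 = 1%:M :> 'M[F]_(m + m).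
  by mxb; rewrite -scalar_mx_block.
by case/mulmx1_unit.
Qed.

Lemma Qgrp_unit : {in Q, forall w, w \in unitmx}.
Proof.
move=> w; rewrite QgrpE => /and4P[/eqP orth _ _ _]; have := Jform_unit.
by rewrite -orth unitmx_mul => /andP[].
Qed.

Lemma Qgrp1 : 1%:M \in Q.
Proof.
rewrite QgrpE /inQ trmx1 mul1mx mulmx1 eqxx scalar_mx_block block_mxKul block_mxKdl block_mxKdr.
by rewrite scalar_mx_block block_mxKdl linear0 det1 !eqxx.
Qed.

Lemma QgrpM : {in Q &, forall v w, v *m w \in Q}.
Proof.
move=> v w vQ wQ; rewrite QgrpE /inQ; apply/andP; split.
  move: vQ wQ; rewrite !QgrpE => /and4P[/eqP vo _ _ _] /and4P[/eqP wo _ _ _].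
  by rewrite trmx_mul mulmxA -(mulmxA w^T) -(mulmxA w^T) vo wo.
case/QgrpP: vQ => A [i [B [h [/and3P[_ iS _] ->]]]].
case/QgrpP: wQ => A' [i' [B' [h' [/and3P[_ iS' _] ->]]]].
rewrite /qmx; mxb; rewrite block_mxKul block_mxKdl block_mxKdr block_mxKdl row_mxKl !eqxx /=.
move: iS iS'; rewrite !inE det_mulmx => /andP[_ /eqP->] /andP[_ /eqP->].
by rewrite mulr1.
Qed.
End Parabolic.

Section SumParabolic.
Variables (F : finFieldType) (eps : F) (epsN : ~~ issq eps) (m : nat).
Local Notation delta := (deltaeps eps).
Local Notation Q := (Qgrp m.+1 eps).

Lemma orthM d (J a b : 'M[F]_d) : a^T *m J *m a = J -> b^T *m J *m b = J ->
  (a *m b)^T *m J *m (a *m b) = J.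
Proof.
by move=> ao bo; rewrite trmx_mul mulmxA -(mulmxA b^T) -(mulmxA b^T) ao bo.
Qed.

Lemma sum_Qgrp (V : nmodType) (phi : 'M[F]_(m + m + 2) -> V) :
  \sum_(w in Q) phi w =
  \sum_(A : 'M[F]_m | A \in unitmx) \sum_(i in SOm2 eps) \sum_(h : 'M[F]_(2, m))
    \sum_(B : 'M[F]_m | B^T + B + h^T *m delta *m h == 0) phi (qmx eps A i B h).
Proof.
rewrite pair_big_dep /= pair_big_dep /= pair_big_dep /=.
pose f (p : 'M[F]_m * 'M[F]_2 * 'M[F]_(2, m) * 'M[F]_m) :=
  qmx eps p.1.1.1 p.1.1.2 p.2 p.1.2.
rewrite -(big_imset (h := f)) /=; last first.
  move=> [[[A i] h] B] [[[A' i'] h'] B']; rewrite !unfold_in /= /f /= !andbT.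
  move=> /andP[/andP[Au iS] _] _ /eq_block_mx[/eq_block_mx[eA eAB _ _] _ eih ei].
  move: eAB eih; rewrite -eA -ei => /(can_inj (mulKmx Au)) <- /eq_row_mx[_].
  by move/(can_inj (mulKmx (SOm2_unit iS))) <-.
apply: eq_bigl => w; apply/QgrpP/imsetP => [[A [i [B [h [/and3P[Au iS Bh] ->]]]]]|[[[[A i] h]
  B]]].
  by exists (A, i, h, B); rewrite // unfold_in /= Au iS Bh.
rewrite unfold_in /= andbT => /andP[/andP[Au iS] Bh] ->.
by exists A, i, B, h; split=> //; apply/and3P.
Qed.

End SumParabolic.

(** * Block forms of sigma_r and rho *)

Section Sigma.
Variables (F : finFieldType) (r k : nat).
Local Notation m := (r + k)%N.

(** [E1] and [E0] are complementary idempotents: they select the r coordinates that sigma_r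
    exchanges and the k = n - 1 - r that it fixes. *)
Definition E1 : 'M[F]_m := block_mx 1%:M 0 0 0.
Definition E0 : 'M[F]_m := block_mx 0 0 0 1%:M.
Definition sigmab : 'M[F]_(m + m + 2) := block_mx (block_mx E0 E1 E1 E0) 0 0 1%:M.
(** The parameter t, equal to 1 or -1, treats the cosets without and with rho uniformly. *)
Definition diag2 (t : F) : 'M[F]_2 := \matrix_(i, j) (if i == j then if i == 0 then 1 else t
  else 0).
Definition rhob (t : F) : 'M[F]_(m + m + 2) := block_mx 1%:M 0 0 (diag2 t).

Lemma E1E (i j : 'I_m) : E1 i j = ((i == j :> nat) && (i < r)%N)%:R.
Proof.
rewrite /E1 mxE; case: (splitP i) => i' ->; rewrite mxE; case: (splitP j) => j' ->;
  rewrite mxE ?ltn_ord ?andbT.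
- by [].
- by rewrite (ltn_eqF (ltn_addr _ (ltn_ord i'))).
- by rewrite andbF.
- by rewrite andbF.
Qed.

Lemma E0E (i j : 'I_m) : E0 i j = ((i == j :> nat) && (r <= i)%N)%:R.
Proof.
rewrite /E0 mxE; case: (splitP i) => i' ->; rewrite mxE; case: (splitP j) => j' ->; rewrite mxE.
- by rewrite leqNgt ltn_ord andbF.
- by rewrite (ltn_eqF (ltn_addr _ (ltn_ord i'))).
- by rewrite (gtn_eqF (ltn_addr _ (ltn_ord j'))).
- by rewrite leq_addr andbT eqn_add2l.
Qed.

Lemma sigmaE : sigma F m.+1 r = sigmab.
Proof.
have swapE x : sigma_swap m.+1 r x =
  if (x < r)%N then (x + m)%N else if (m <= x < m + r)%N then (x - m)%N else x by [].
have ifE (b : bool) : (if b then 1 else 0) = b%:R :> F by case: b.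
have eq0 (b : bool) : b = false -> b%:R = 0 :> F by move->.
have eqb (b c : bool) : b = c -> b%:R = c%:R :> F by move->.
suff E (i j : 'I_(m + m + 2)) : sigma F m.+1 r i j = sigmab i j by apply/matrixP.
rewrite /sigma /sigmab mxE swapE ifE !mxE.
case: (splitP i) => i' ->; rewrite ?mxE; case: (splitP j) => j' ->; rewrite ?mxE;
  have := ltn_ord i'; have := ltn_ord j'.
- case: (splitP i') => i'' ->; rewrite mxE; case: (splitP j') => j'' ->; rewrite ?E1E ?E0E;
  have := ltn_ord i''; have := ltn_ord j''; move=> *; apply: eqb;
  do 2?[case: ifP => ?]; lia.
- by move=> *; apply: eq0; do 2?[case: ifP => ?]; lia.
- by move=> *; apply: eq0; do 2?[case: ifP => ?]; lia.
- by move=> *; apply: eqb; rewrite -(inj_eq val_inj) /=; do 2?[case: ifP => ?]; lia.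
Qed.

Lemma rhobN1 : rho F m.+1 = rhob (-1).
Proof.
suff E (i j : 'I_(m + m + 2)) : rho F m.+1 i j = rhob (-1) i j by apply/matrixP.
have dE : ((m.+1.-1 + m.+1.-1 + 2).-1 = m + m + 1)%N by rewrite /= addn2 addn1.
rewrite /rho /rhob mxE dE !mxE -[i == j](inj_eq val_inj) /=.
case: (splitP i) => i' ->; rewrite ?mxE; case: (splitP j) => j' ->; rewrite ?mxE;
  have := ltn_ord i'; have := ltn_ord j'.
- rewrite -[i' == j'](inj_eq val_inj) /= => ? ?; case: eqP => // _; case: eqP => //; lia.
- by move=> ? ?; case: eqP => //; lia.
- by move=> ? ?; case: eqP => //; lia.
by case: i' => [[|[|[]]]] // ?; case: j' => [[|[|[]]]] //= ? ? ?; rewrite !eqn_add2l.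
Qed.

Lemma rhob1 : rhob 1 = 1%:M.
Proof.
rewrite /rhob [RHS]scalar_mx_block; congr block_mx.
by apply/matrixP=> i j; rewrite !mxE; case: ifP => //; rewrite if_same.
Qed.

Lemma diag2K t : t * t = 1 -> diag2 t *m diag2 t = 1%:M.
Proof.
move=> tt; apply: eq_mx2; rewrite !mxE !big_ord_recl !big_ord0 !mxE /=.
by split; rewrite ?tt; ring.
Qed.

Lemma rhobK t : t * t = 1 -> rhob t *m rhob t = 1%:M.
Proof. by move=> tt; rewrite /rhob; mxb; rewrite diag2K // -scalar_mx_block. Qed.

Lemma E0K : E0 *m E0 = E0. Proof. by rewrite /E0; mxb. Qed.
Lemma E1K : E1 *m E1 = E1. Proof. by rewrite /E1; mxb. Qed.
Lemma E01 : E0 *m E1 = 0. Proof. by rewrite /E0 /E1; mxb. Qed.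
Lemma E10 : E1 *m E0 = 0. Proof. by rewrite /E0 /E1; mxb. Qed.
Lemma addE : E0 + E1 = 1%:M.
Proof. by rewrite /E0 /E1; mxb; rewrite -scalar_mx_block. Qed.
Lemma trE0 : E0^T = E0. Proof. by rewrite /E0; mxb. Qed.
Lemma trE1 : E1^T = E1. Proof. by rewrite /E1; mxb. Qed.

Lemma sigmabK : sigmab *m sigmab = 1%:M.
Proof.
(* Only the relations between the idempotents are needed, so they are generalised and stay atoms for
   [mxb]. *)
rewrite /sigmab; move: E0 E1 E0K E1K E01 E10 addE => e0 e1 e00 e11 e01 e10 e0e1.
by mxb; rewrite e00 e11 e01 e10; mxb; rewrite [e1 + e0]addrC e0e1 -!scalar_mx_block.
Qed.

Variables (eps : F) (epsN : ~~ issq eps).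
Local Notation delta := (deltaeps eps).
Local Notation Q := (Qgrp m.+1 eps).

Lemma diag2_delta t : t * t = 1 -> (diag2 t)^T *m delta *m diag2 t = delta.
Proof.
move=> tt; apply: eq_mx2; rewrite !mxE !big_ord_recl !big_ord0 !mxE !big_ord_recl !big_ord0
  !mxE /=.
by split; try ring; rewrite -[RHS]mulr1 -tt; ring.
Qed.

Lemma rhob_Qgrp t : t * t = 1 -> {in Q, forall w, rhob t *m w *m rhob t \in Q}.
Proof.
move=> tt w /QgrpP[A [i [B [h [qp ->]]]]]; have := qmx_inQ qp.
rewrite QgrpE => /and4P[/eqP orth _ _ _]; apply/andP; split.
  have rho_orth : (rhob t)^T *m Jform eps m *m rhob t = Jform eps m.
    by rewrite /rhob /Jform; mxb; rewrite diag2_delta.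
  by apply/eqP; do 2?apply: orthM.
move: qp => /and3P[_ + _]; rewrite inE => /andP[_ /eqP deti].
rewrite /qmx /rhob; mxb; rewrite block_mxKul block_mxKdl block_mxKdr block_mxKdl row_mxKl !eqxx
  /=.
by rewrite !det_mulmx deti mulr1 -det_mulmx diag2K // det1.
Qed.

Lemma sigmab_orth : sigmab^T *m Jform eps m *m sigmab = Jform eps m.
Proof.
rewrite /sigmab /Jform.
move: E0 E1 E0K E1K E01 E10 addE trE0 trE1 => e0 e1 e00 e11 e01 e10 e0e1 te0 te1.
by mxb; rewrite te0 te1 e00 e11 e01 e10; mxb; rewrite ?[e1 + e0]addrC e0e1.
Qed.

(** B enters linearly, and only against the first r rows of A, which make up E1 A; h does not enter
    directly but only through the equation that ties it to B. *)
Lemma tr_qmx_sigmab t A i B h :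
  \tr (rhob t *m (qmx eps A i B h *m sigmab)) =
  \tr (E1 *m A *m B) + \tr (drsubmx A) + \tr (drsubmx (invmx A)) + \tr (diag2 t *m i).
Proof.
have trME0 (M : 'M[F]_m) : \tr (M *m E0) = \tr (drsubmx M).
  by rewrite -{1}[M]submxK /E0; mxb; rewrite mxtrace_block linear0 add0r.
rewrite -trME0 -(mxtrace_tr (drsubmx _)) trmx_drsub -trME0 -mulmxA [\tr (E1 *m _)]mxtrace_mulC.
rewrite /rhob /qmx /sigmab; move: E0 E1 => e0 e1; mxb.
by rewrite !mxtrace_block !linearD /=; congr (_ + _); rewrite [X in X + _]addrC.
Qed.
End Sigma.

(** * Trace sums over the parabolic subgroup *)

Section Main.
Variables (F : finFieldType) (char3 : 3%:R = 0 :> F).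
Variables (eps : F) (epsN : ~~ issq eps) (r k : nat).
Local Notation delta := (deltaeps eps).
Local Notation m := (r + k)%N.
Local Notation Q := (Qgrp m.+1 eps).
Local Notation sg := (sigmab F r k).
Local Notation q := #|F|.

Definition gl n := #|[set A : 'M[F]_n | A \in unitmx]|.

Lemma glE n : gl n = (\sum_(A : 'M[F]_n) (A \in unitmx))%N.
Proof. by rewrite /gl -sum1dep_card big_mkcond; apply: eq_bigr => S _; case: ifP. Qed.

Lemma unitmx_lblock (A : 'M[F]_r) (C : 'M_(k, r)) (D : 'M_k) :
  (block_mx A 0 C D \in unitmx) = (A \in unitmx) && (D \in unitmx).
Proof. by rewrite !unitmxE det_lblock unitrM. Qed.

Lemma invmx_lblock (A : 'M[F]_r) (C : 'M_(k, r)) (D : 'M_k) :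
  block_mx A 0 C D \in unitmx ->
  ursubmx (invmx (block_mx A 0 C D)) = 0 /\
  drsubmx (invmx (block_mx A 0 C D)) = invmx D.
Proof.
move=> M; have := M; rewrite unitmx_lblock => /andP[Au Du].
have := mulmxV M; rewrite -[invmx (block_mx _ _ _ _)]submxK; set X := invmx _.
rewrite scalar_mx_block mulmx_block block_mxKur block_mxKdr => /eq_block_mx[_ + _].
rewrite mul0mx addr0 => AX.
have X12 : ursubmx X = 0 by rewrite -[ursubmx X](mulKmx Au) AX mulmx0.
rewrite X12 mulmx0 add0r => DX; split=> //.
by rewrite -[drsubmx X](mulKmx Du) DX mulmx1.
Qed.

(** As 3 H = 0, the matrix H is itself a solution, and the solutions form a coset of the alternating
    matrices. *)
Lemma sum_alt_shift n (H : 'M[F]_n) : H^T = H ->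
  (\sum_(B : 'M[F]_n) (B^T + B + H == 0)%R)%N = nalt F n.
Proof.
move=> Hs; rewrite naltE (reindex_inj (addIr H)); apply: eq_bigr => C _.
rewrite linearD /= Hs; congr nat_of_bool.
have -> : C^T + H + (C + H) + H = C^T + C + H *+ 3.
  by rewrite !mulrS mulr0n addr0 -!addrA; congr (_ + _); rewrite addrCA.
by rewrite -scaler_nat char3 scale0r addr0 addr_eq0.
Qed.

(** Orthogonality and the determinant of i survive the conjugation, so only the two vanishing blocks
    of [inQ] have to be read off; the invertible factors i and A11 then drop out. *)
Lemma conj_stab_qmx A i B h : qpar eps A i B h ->
  (sg *m qmx eps A i B h *m sg \in Q) =
  [&& ursubmx A == 0, lsubmx h == 0 & ulsubmx B == 0].
Proof.
move=> qp; rewrite QgrpE /inQ; have := qmx_inQ qp.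
rewrite /inQ => /and4P[/eqP orth _ _ _].
rewrite (orthM (orthM (sigmab_orth r k eps) orth) (sigmab_orth r k eps)) eqxx /=.
case/and3P: qp => Au iS _; have := iS; rewrite inE => /andP[_ /eqP deti].
have -> : dlsubmx (ulsubmx (sg *m qmx eps A i B h *m sg)) =
  E1 F r k *m A *m E0 F r k + (E1 F r k *m (A *m B) + E0 F r k *m (invmx A)^T) *m E1 F r k.
  rewrite /sigmab /qmx; move: (E0 F r k) (E1 F r k) => e0 e1; mxb.
  by rewrite block_mxKul block_mxKdl.
have -> : lsubmx (dlsubmx (sg *m qmx eps A i B h *m sg)) = i *m h *m E1 F r k.
  rewrite /sigmab /qmx; move: (E0 F r k) (E1 F r k) => e0 e1; mxb.
  by rewrite block_mxKdl row_mxKl.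
have -> : drsubmx (sg *m qmx eps A i B h *m sg) = i.
  rewrite /sigmab /qmx; move: (E0 F r k) (E1 F r k) => e0 e1; mxb.
  by rewrite block_mxKdr.
rewrite deti eqxx andbT.
have -> : (i *m h *m E1 F r k == 0) = (lsubmx h == 0).
  rewrite -mulmxA; have iu := SOm2_unit iS.
  have -> : (i *m (h *m E1 F r k) == 0) = (h *m E1 F r k == 0).
    by rewrite -[RHS](inj_eq (can_inj (mulKmx iu))) mulmx0.
  rewrite -{1}[h]hsubmxK /E1; mxb.
  by rewrite row_mx_eq0 eqxx andbT.
rewrite andbC [RHS]andbCA; congr (_ && _).
set A11 := ulsubmx A; set A21 := dlsubmx A; set A22 := drsubmx A.
have -> : E1 F r k *m A *m E0 F r k + (E1 F r k *m (A *m B) + E0 F r k *m (invmx A)^T) *m E1 F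
  r k =
  block_mx (A11 *m ulsubmx B + ursubmx A *m dlsubmx B) (ursubmx A) (ursubmx (invmx A))^T 0.
  rewrite -{1 2}[A]submxK -{1}[B]submxK -[(invmx A)^T]submxK /E1 /E0; mxb.
  by rewrite trmx_ursub.
rewrite block_mx_eq0 eqxx andbT.
have [A12|_] := eqVneq (ursubmx A) 0; last by rewrite andbF.
have := Au; rewrite -[A]submxK A12 => Au'; have [X12 _] := invmx_lblock Au'.
rewrite X12 trmx0 block_mxKur mul0mx addr0 eqxx !andbT /=.
move: Au'; rewrite unitmx_lblock => /andP[A11u _].
by rewrite -[RHS](inj_eq (can_inj (mulKmx A11u))) mulmx0.
Qed.

Lemma sum_lower_units :
  (\sum_(A : 'M[F]_m | A \in unitmx) (ursubmx A == 0%R) = gl r * (q ^ (k * r) * gl k))%N.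
Proof.
rewrite big_mkcond sum_block_mx glE big_distrl; apply: eq_bigr => A11 _ /=.
rewrite (bigD1 0) //= [X in (_ + X)%N = _]big1 ?addn0 => [|A12 nz].
  rewrite (eq_bigr (fun _ => (A11 \in unitmx) * gl k)%N) => [|A21 _].
    by rewrite sum_nat_const card_mx mulnCA.
  rewrite glE big_distrr; apply: eq_bigr => A22 _.
  by rewrite unitmx_lblock block_mxKur eqxx; case: (A11 \in _) (A22 \in _) => [] [].
apply: big1 => A21 _; apply: big1 => A22 _.
by rewrite block_mxKur (negPf nz) if_same.
Qed.

Lemma tr_hdh n (h : 'M[F]_(2, n)) : (h^T *m delta *m h)^T = h^T *m delta *m h.
Proof. by rewrite !trmx_mul trmxK tr_delta mulmxA. Qed.

(** The last k columns of h and the block B12 are free, B21 is minus the transpose of B12, and B22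
    runs over a coset of the alternating matrices. *)
Lemma sum_unip_stab :
  (\sum_(h : 'M[F]_(2, m)) \sum_(B : 'M[F]_m | (B^T + B + h^T *m delta *m h == 0)%R)
    ((lsubmx h == 0%R) && (ulsubmx B == 0%R)) = q ^ (2 * k) * (q ^ (r * k) * nalt F k))%N.
Proof.
rewrite sum_row_mx (bigD1 0) //= [X in (_ + X)%N = _]big1 ?addn0 => [|h1 nz]; last first.
  by apply: big1 => h2 _; apply: big1 => B _; rewrite row_mxKl (negPf nz).
rewrite (eq_bigr (fun _ => q ^ (r * k) * nalt F k))%N; first by rewrite sum_nat_const card_mx.
move=> h _.
have hdh : (row_mx 0 h)^T *m delta *m row_mx 0 h = block_mx 0 0 0 (h^T *m delta *m h) :> 'M_(r
  + k).
  by mxb; rewrite block_mxEh col_mx0.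
rewrite hdh big_mkcond sum_block_mx (bigD1 0) //= [X in (_ + X)%N = _]big1 ?addn0 => [|B11 nz];
  last first.
  by apply: big1 => B12 _; apply: big1 => B21 _; apply: big1 => B22 _;
    rewrite block_mxKul (negPf nz) andbF if_same.
rewrite (eq_bigr (fun _ => nalt F k)); first by rewrite sum_nat_const card_mx.
move=> B12 _; rewrite (bigD1 (- B12^T)) //= [X in (_ + X)%N = _]big1 ?addn0 => [|B21 nz].
  rewrite -(sum_alt_shift (tr_hdh h)); apply: eq_bigr => B22 _.
  rewrite row_mxKl block_mxKul !eqxx /=; mxb; rewrite linearN /= trmxK addrN addNr.
  rewrite block_mx_eq0 !eqxx /=; by case: ifP.
apply: big1 => B22 _; mxb; rewrite block_mx_eq0.
case: ifP => // /and4P[_ _ /eqP e _]; move: nz; rewrite -addr_eq0 addrC.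
by rewrite e eqxx.
Qed.

Lemma card_conj_stab : #|conj_stab Q sg| =
  (gl r * (q ^ (k * r) * gl k) * ((q + 1) * (q ^ (2 * k) * (q ^ (r * k) * nalt F k))))%N.
Proof.
have -> : #|conj_stab Q sg| = (\sum_(w in Q) (sg *m w *m sg \in Q))%N.
  rewrite -sum1_card big_mkcond [RHS]big_mkcond; apply: eq_bigr => w _.
  by rewrite inE; case: (w \in Q); case: (_ \in Q).
rewrite sum_Qgrp -sum_lower_units big_distrl; apply: eq_bigr => A Au.
rewrite /= -sum_unip_stab -(card_SOm2 (two_neq0 char3) epsN) mulnCA -sum_nat_const.
apply: eq_bigr => i iS; rewrite big_distrr; apply: eq_bigr => h _.
rewrite big_distrr; apply: eq_bigr => B Bh; rewrite conj_stab_qmx; last exact/and3P.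
by rewrite /= mulnb.
Qed.

(* B may be translated by any alternating matrix, and C |-> tr (M C) is nonzero on
   these unless M is symmetric. *)
Lemma lin_dev_nonsym n (M H : 'M[F]_n) (b : F) : M^T != M ->
  \sum_(B : 'M[F]_n | B^T + B + H == 0) dev (\tr (M *m B) + b) = 0.
Proof.
move=> Mns.
have /existsP[x /existsP[y xy]] : [exists x, exists y, M x y != M y x].
  apply: contraNT Mns => /existsPn Ms; apply/eqP/matrixP=> x y.
  rewrite mxE; apply/eqP; move: (Ms y); rewrite negb_exists => /forallP/(_ x).
  by rewrite negbK.
have c0 : M x y - M y x != 0 by rewrite subr_eq0.
pose C := (M x y - M y x)^-1 *: (delta_mx y x - delta_mx x y) : 'M[F]_n.
have trd (z t : 'I_n) : \tr (M *m delta_mx z t) = M t z.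
  rewrite /mxtrace (bigD1 t) //= big1 ?addr0 => [|u ut].
    rewrite mxE (bigD1 z) //= big1 ?addr0 => [|v vz]; first by rewrite mxE !eqxx mulr1.
    by rewrite mxE (negPf vz) mulr0.
  by rewrite mxE big1 // => v _; rewrite mxE (negPf ut) andbF mulr0.
have trC : \tr (M *m C) = 1.
  by rewrite -scalemxAr linearZ /= mulmxBr linearB /= !trd mulVf.
have CT : C^T = - C by rewrite linearZ linearB /= !trmx_delta -scalerN opprB.
pose g t (B : 'M[F]_n) := B + t *: C.
apply: (@sum_dev_linear _ _ _ (fun B => \tr (M *m B)) g) => [t B /eqP Bh|t B|t B].
- apply/eqP; rewrite -[RHS]Bh /g linearD linearZ /= CT scalerN; congr (_ + _).
  by rewrite addrACA addNr addr0.
- by rewrite /g scaleNr addrK.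
- by rewrite /g mulmxDr linearD /= -scalemxAr linearZ /= trC mulr1.
Qed.

(** For symmetric M the constraint fixes the trace: 2 tr(M B) = - tr(M h^T delta h), and 2 = -1
    cancels the sign. The sum over B is then constant. *)
Lemma lin_dev_sym n (M : 'M[F]_n) (h : 'M[F]_(2, n)) (b : F) : M^T = M ->
  \sum_(B : 'M[F]_n | B^T + B + h^T *m delta *m h == 0) dev (\tr (M *m B) + b) =
  (nalt F n)%:R * dev (\tr (delta *m h *m M *m h^T) + b).
Proof.
move=> Ms; rewrite -(sum_alt_shift (tr_hdh h)) natr_sum big_distrl [LHS]big_mkcond /=.
apply: eq_bigr => B _; case: eqP => [Bh|_]; last by rewrite mul0r.
rewrite mul1r; congr (dev (_ + _)).
have trBT : \tr (M *m B^T) = \tr (M *m B).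
  by rewrite -mxtrace_tr trmx_mul trmxK Ms mxtrace_mulC.
have E : \tr (M *m B) *+ 2 + \tr (M *m (h^T *m delta *m h)) = 0.
  have := congr1 (fun X => \tr (M *m X)) Bh.
  by rewrite !mulmxDr mulmx0 linear0 !linearD /= trBT mulr2n.
have -> : \tr (delta *m h *m M *m h^T) = \tr (M *m (h^T *m delta *m h)).
  by rewrite mxtrace_mulC [RHS]mxtrace_mulC -!mulmxA.
move: E; rewrite -mulr_natl (two_eqN1 char3) mulN1r addrC => /eqP.
by rewrite subr_eq0 eq_sym => /eqP.
Qed.

(** Origin of the factors: [nalt F m] counts the B, q^(2k) the columns of h outside the quadratic
    form, q^(kr) the blocks A21, [nsym F r] the blocks A11, and (-q)^r is the value of
    [sum_dev_form]. *)
Lemma sum_dev_Qgrp (t b : F) :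
  \sum_(w in Q) dev (\tr (rhob r k t *m (w *m sg)) - b) =
  (nalt F m * q ^ (2 * k) * q ^ (k * r) * nsym F r)%:R * (- q%:R) ^+ r *
  \sum_(X : 'M[F]_k | X \in unitmx) \sum_(i in SOm2 eps)
    dev (\tr X + \tr (invmx X) + \tr (diag2 t *m i) - b).
Proof.
pose M (A : 'M[F]_m) := E1 F r k *m A.
pose c (A : 'M[F]_m) i := \tr (drsubmx A) + \tr (drsubmx (invmx A)) + \tr (diag2 t *m i) - b.
rewrite sum_Qgrp.
pose G (A : 'M[F]_m) := \sum_(i in SOm2 eps) \sum_(h : 'M[F]_(2, m))
  \sum_(B : 'M[F]_m | B^T + B + h^T *m delta *m h == 0) dev (\tr (M A *m B) + c A i).
transitivity (\sum_(A : 'M[F]_m | A \in unitmx) G A).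
  apply: eq_bigr => A _; apply: eq_bigr => i _; apply: eq_bigr => h _; apply: eq_bigr => B _.
  by rewrite tr_qmx_sigmab /c /M !addrA.
have G0 A : (M A)^T != M A -> G A = 0.
  by move=> ns; rewrite /G big1 // => i _; rewrite big1 // => h _; exact: lin_dev_nonsym.
have MA A11 A12 A21 A22 : M (block_mx A11 A12 A21 A22) = block_mx A11 A12 0 0.
  by rewrite /M /E1; mxb.
(* E1 A has first block row (A11, A12) and zeros below, so it is symmetric exactly when A11 is
   symmetric and A12 = 0; then A is invertible exactly when A11 and A22 are. *)
rewrite big_mkcond sum_block_mx.
rewrite (eq_bigr (fun A11 : 'M_r => \sum_(A21 : 'M_(k, r)) \sum_(A22 : 'M_k)
    if (A11^T == A11) && (A11 \in unitmx) && (A22 \in unitmx) then G (block_mx A11 0 A21 A22)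
      else 0)); last first.
  move=> A11 _; rewrite (bigD1 0) //= [X in _ + X = _]big1 ?addr0 => [|A12 nz].
    apply: eq_bigr => A21 _; apply: eq_bigr => A22 _; rewrite unitmx_lblock.
    have [s|ns] := boolP (A11^T == A11); first by [].
    case: ifP => // _; apply: G0; rewrite MA tr_block_mx; apply: contraNneq ns.
    by case/eq_block_mx=> ->.
  apply: big1 => A21 _; apply: big1 => A22 _; case: ifP => // _; apply: G0.
  by rewrite MA tr_block_mx trmx0; apply: contraNneq nz => /eq_block_mx[_ <- _ _].
pose K (A22 : 'M[F]_k) i := \tr A22 + \tr (invmx A22) + \tr (diag2 t *m i) - b.
have GE A11 A21 A22 : A11^T = A11 -> A11 \in unitmx -> A22 \in unitmx ->
  G (block_mx A11 0 A21 A22) =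
  (nalt F m)%:R * (q ^ (2 * k))%:R * (- q%:R) ^+ r * \sum_(i in SOm2 eps) dev (K A22 i).
  move=> s A11u A22u; rewrite /G mulr_sumr; apply: eq_bigr => i _.
  have Au : block_mx A11 0 A21 A22 \in unitmx by rewrite unitmx_lblock A11u.
  have cE : c (block_mx A11 0 A21 A22) i = K A22 i.
    by rewrite /c /K block_mxKdr; have [_ ->] := invmx_lblock Au.
  have Ms : (M (block_mx A11 0 A21 A22))^T = M (block_mx A11 0 A21 A22).
    by rewrite MA; mxb; rewrite s.
  under eq_bigr => h _ do rewrite (lin_dev_sym _ _ Ms) MA cE.
  rewrite -mulr_sumr -!mulrA; congr (_ * _).
  rewrite sum_row_mx.
  under eq_bigr => h1 _.
    under eq_bigr => h2 _.
      rewrite (_ : \tr _ = \tr (delta *m h1 *m A11 *m h1^T)); last by mxb.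
      over.
    rewrite sumr_const card_mx -mulr_natl.
    over.
  by rewrite -mulr_sumr (sum_dev_form (two_neq0 char3) epsN).
have -> : (nalt F m * q ^ (2 * k) * q ^ (k * r) * nsym F r)%:R * (- q%:R) ^+ r *
  \sum_(X | X \in unitmx) \sum_(i in SOm2 eps) dev (K X i) =
  \sum_(A11 : 'M[F]_r) \sum_(A21 : 'M[F]_(k, r)) \sum_(A22 : 'M_k)
   ((A11^T == A11) && (A11 \in unitmx))%:R *
   ((nalt F m)%:R * (q ^ (2 * k))%:R * (- q%:R) ^+ r * if A22 \in unitmx then \sum_(i in SOm2
     eps) dev (K A22 i) else 0).
  under [RHS]eq_bigr => A11 _.
    under eq_bigr => A21 _ do rewrite -mulr_sumr -mulr_sumr -big_mkcond.
    rewrite sumr_const card_mx -mulrnAr.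
    over.
  rewrite -mulr_suml -natr_sum -nsymE !natrM -mulr_natr.
  by rewrite /=; ring.
apply: eq_bigr => A11 _; apply: eq_bigr => A21 _; apply: eq_bigr => A22 _.
case: (A11^T =P A11) => [s|_]; last by rewrite mul0r.
case A11u: (A11 \in unitmx); last by rewrite mul0r.
case A22u: (A22 \in unitmx); last by rewrite !mulr0.
by rewrite mul1r GE.
Qed.
End Main.

(** * Closed forms *)

Section ClosedForms.
Variable q : rat.

(* Closed forms of |GL_n(q)| (GLq), of the number of nonsingular symmetric
   n x n matrices (Symq), of |Q| (Qq) and of the fibres of Q x Q -> Q sigma_r Q
   (Stabq); Wq is the absolute value of the factor in sum_dev_Qgrp. *)
Definition GLq (n : nat) : rat := q ^+ 'C(n, 2) * \prod_(1 <= i < n.+1) (q ^+ i - 1).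
Definition Symq (n : nat) : rat := q ^+ (n./2 * n./2 + n./2) * prododd q (uphalf n).
Definition Qq (m : nat) : rat := GLq m * ((q + 1) * (q ^+ (2 * m) * q ^+ 'C(m, 2))).
Definition Stabq (r k : nat) : rat :=
  GLq r * (q ^+ (k * r) * GLq k) * ((q + 1) * (q ^+ (2 * k) * (q ^+ (r * k) * q ^+ 'C(k, 2)))).
Definition Wq (r k : nat) : rat :=
  q ^+ 'C(r + k, 2) * q ^+ (2 * k) * q ^+ (k * r) * Symq r * q ^+ r.

Lemma prododdS t : prododd q t.+1 = prododd q t * (q ^+ (2 * t + 1) - 1).
Proof. by rewrite /prododd big_nat_recr //=; congr (_ * (q ^+ _ - 1)); lia. Qed.

Lemma prodevenS t : prodeven q t.+1 = prodeven q t * (q ^+ (2 * t + 2) - 1).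
Proof. by rewrite /prodeven big_nat_recr //=; congr (_ * (q ^+ _ - 1)); lia. Qed.

Lemma prod_parity t : \prod_(1 <= i < (2 * t).+1) (q ^+ i - 1) = prododd q t * prodeven q t.
Proof.
elim: t => [|t IHt]; first by rewrite /prododd /prodeven !big_geq // mulr1.
rewrite (_ : (2 * t.+1).+1 = (2 * t).+3)%N; last lia.
rewrite big_nat_recr //= big_nat_recr //= IHt prododdS prodevenS.
by rewrite addn1 addn2; ring.
Qed.

Variable t : nat.
Local Notation x := (q ^+ t).
Local Notation y := (q ^+ (t * t)).
Local Notation p := (prododd q t).
Local Notation e := (prodeven q t).

(** All exponents are quadratic polynomials in t. As monomials in q, x = q^t and y = q^(t^2), with
    x, y and both products generalised, the identities below become rational identities in
    independent variables. *)
Lemma expq a b c : q ^+ (t * t * a + t * b + c) = y ^+ a * x ^+ b * q ^+ c.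
Proof. by rewrite !exprD !exprM. Qed.

Lemma q2t c : q ^+ (2 * t + c) = x ^+ 2 * q ^+ c.
Proof. by rewrite exprD mulnC exprM. Qed.

Lemma q2tS c : q ^+ (c + 2 * t) = x ^+ 2 * q ^+ c.
Proof. by rewrite addnC q2t. Qed.

Lemma q2t0 : q ^+ (2 * t) = x ^+ 2. Proof. by rewrite mulnC exprM. Qed.

Lemma q4t0 : q ^+ (2 * (2 * t)) = x ^+ 4. Proof. by rewrite mulnA mulnC exprM. Qed.

Lemma q4t c : q ^+ (2 * (2 * t + c)) = x ^+ 4 * q ^+ (2 * c).
Proof. by rewrite mulnDr exprD mulnA (mulnC _ t) exprM. Qed.

Lemma bin_2t1 : q ^+ 'C((2 * t).+1, 2) = y ^+ 2 * x.
Proof.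
rewrite (_ : 'C(_, _) = t * t * 2 + t * 1 + 0)%N; first by rewrite expq expr1 mulr1.
rewrite bin2; lia.
Qed.
Lemma bin_2t2 : q ^+ 'C((2 * t).+2, 2) = y ^+ 2 * x ^+ 3 * q.
Proof.
rewrite (_ : 'C(_, _) = t * t * 2 + t * 3 + 1)%N; first by rewrite expq.
rewrite bin2; lia.
Qed.
Lemma bin_2t3 : q ^+ 'C((2 * t).+3, 2) = y ^+ 2 * x ^+ 5 * q ^+ 3.
Proof.
rewrite (_ : 'C(_, _) = t * t * 2 + t * 5 + 3)%N; first by rewrite expq.
rewrite bin2; lia.
Qed.

Lemma Symq_2t : Symq (2 * t) = y * x * p.
Proof.
rewrite /Symq (_ : (2 * t)./2 = t)%N; last lia.
by rewrite (_ : uphalf (2 * t) = t)%N ?exprD //; lia.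
Qed.
Lemma Symq_2t1 : Symq (2 * t).+1 = y * x * (p * (x ^+ 2 * q - 1)).
Proof.
rewrite /Symq (_ : (2 * t).+1./2 = t)%N; last lia.
rewrite (_ : uphalf (2 * t).+1 = t.+1)%N ?prododdS ?q2t ?exprD //; lia.
Qed.

Hypothesis q_gt1 : 1 < q.

Lemma q_neq0 : q != 0. Proof. by rewrite gt_eqF // (lt_trans _ q_gt1). Qed.
Lemma x_neq0 : x != 0. Proof. by rewrite expf_neq0 // q_neq0. Qed.
Lemma y_neq0 : y != 0. Proof. by rewrite expf_neq0 // q_neq0. Qed.
Lemma qB1_neq0 : q - 1 != 0. Proof. by rewrite subr_eq0 gt_eqF. Qed.
Lemma qqB1_neq0 : q ^+ 2 - 1 != 0.
Proof.
rewrite (_ : q ^+ 2 - 1 = (q - 1) * (q + 1)); last by ring.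
by rewrite mulf_neq0 ?qB1_neq0 // gt_eqF // addr_gt0 // (lt_trans _ q_gt1).
Qed.

Lemma bin_2t : q ^+ 'C(2 * t, 2) = y ^+ 2 / x.
Proof.
apply: (mulIf x_neq0); rewrite divfK ?x_neq0 // -exprD -exprM; congr (q ^+ _).
by rewrite bin2; case: t => // k; lia.
Qed.
Lemma GLq_2t : GLq (2 * t) = y ^+ 2 / x * (p * e).
Proof. by rewrite /GLq bin_2t prod_parity. Qed.
Lemma GLq_2t1 : GLq (2 * t).+1 = y ^+ 2 * x * (p * e * (x ^+ 2 * q - 1)).
Proof.
by rewrite /GLq bin_2t1 big_nat_recr //= prod_parity (q2tS 1).
Qed.
Lemma GLq_2t2 : GLq (2 * t).+2 =
  y ^+ 2 * x ^+ 3 * q * (p * e * (x ^+ 2 * q - 1) * (x ^+ 2 * q ^+ 2 - 1)).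
Proof.
rewrite /GLq bin_2t2 big_nat_recr //= big_nat_recr //= prod_parity.
by rewrite (q2tS 1) (q2tS 2).
Qed.
Lemma GLq_2t3 : GLq (2 * t).+3 =
  y ^+ 2 * x ^+ 5 * q ^+ 3 * (p * e * (x ^+ 2 * q - 1) * (x ^+ 2 * q ^+ 2 - 1) * (x ^+ 2 * q ^+
    3 - 1)).
Proof.
rewrite /GLq bin_2t3 big_nat_recr //= big_nat_recr //= big_nat_recr //= prod_parity.
by rewrite (q2tS 1) (q2tS 2) (q2tS 3).
Qed.
Lemma GLq_0 : GLq 0 = 1. Proof. by rewrite /GLq big_geq // mulr1. Qed.
Lemma GLq_1 : GLq 1 = q - 1. Proof. by rewrite /GLq big_nat1 mul1r. Qed.
Lemma GLq_2 : GLq 2 = q * ((q - 1) * (q ^+ 2 - 1)).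
Proof. by rewrite /GLq big_nat_recr //= big_nat1. Qed.

Variable n : nat.

(** The two equations pin down A and B: multiplied they give A B Stab = Q^2, so A B is the size of
    the double coset, and the second gives B as a quotient. *)
Lemma numeric_p1 : n = (2 * t).+2 ->
  Acst q true 1 n * Stabq (2 * t).+1 0 = Qq (2 * t).+1 * Wq (2 * t).+1 0 /\
  Bcst q true 1 n * Wq (2 * t).+1 0 = Qq (2 * t).+1.
Proof.
move=> ->.
rewrite /Acst /Bcst (_ : (5 * _ - _ - 4) %/ 4 = t * t * 5 + t * 9 + 3)%N; last by lia.
rewrite (_ : (_ - 1) = 2 * t + 1)%N; last by lia.
rewrite (_ : (_ - 2) %/ 2 = t)%N; last by lia.
rewrite (_ : (_ ^ 2) %/ 4 = t * t * 1 + t * 2 + 1)%N; last by lia.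
rewrite !expq /Stabq /Qq /Wq addn0 GLq_2t1 GLq_0 Symq_2t1 bin_2t1 muln0 !mul0n.
rewrite -[(2 * t).+1]addn1 q4t !q2t muln0 bin0n /= !expr0.
have := x_neq0; have := y_neq0; move: x y p e => X Y P E x0 y0.
by split; ring.
Qed.

Lemma numeric_m1 : n = (2 * t).+1 ->
  Acst q false 1 n * Stabq (2 * t) 0 = Qq (2 * t) * Wq (2 * t) 0 /\
  Bcst q false 1 n * Wq (2 * t) 0 = Qq (2 * t).
Proof.
move=> ->.
rewrite /Acst /Bcst (_ : (5 * (_ - _)) %/ 4 = t * t * 5 + t * 5 + 0)%N; last by lia.
rewrite (_ : (_ - 1) %/ 2 = t)%N; last by lia.
rewrite (_ : (_ ^ 2) %/ 4 = t * t * 1 + t * 0 + 0)%N; last by lia.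
rewrite !expq /Stabq /Qq /Wq (addn0 (2 * t)%N) GLq_2t GLq_0 Symq_2t bin_2t !muln0 !mul0n.
rewrite q4t0 !q2t0 bin0n /= !expr0.
have := x_neq0; have := y_neq0; move: x y p e => X Y P E x0 y0 .
by split; field.
Qed.

Lemma numeric_p2 : n = (2 * t).+2 ->
  Acst q true 2 n * Stabq (2 * t) 1 = Qq (2 * t).+1 * Wq (2 * t) 1 /\
  Bcst q true 2 n * Wq (2 * t) 1 = Qq (2 * t).+1.
Proof.
move=> ->.
rewrite /Acst /Bcst (_ : (5 * _ - _ - 8) %/ 4 = t * t * 5 + t * 9 + 2)%N; last by lia.
rewrite (_ : (_ - 1) = 2 * t + 1)%N; last by lia.
rewrite (_ : (_ - 2) %/ 2 = t)%N; last by lia.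
rewrite (_ : (_ ^ 2) %/ 4 = t * t * 1 + t * 0 + 0)%N; last by lia.
rewrite /gauss big_nat1 !subn0.
rewrite !expq /Stabq /Qq /Wq addn1 GLq_2t GLq_2t1 GLq_1 Symq_2t bin_2t1 !muln1 !mul1n (_ :
  'C(1, 2) = 0)%N //.
rewrite -[(2 * t).+1]addn1 q4t !q2t !q2t0 /=.
have := qB1_neq0; have := x_neq0; have := y_neq0; move: x y p e => X Y P E x0 y0 q0.
by split; field; rewrite ?x0 ?y0 ?q0.
Qed.

Lemma numeric_m2 : n = (2 * t).+3 ->
  Acst q false 2 n * Stabq (2 * t).+1 1 = Qq (2 * t).+2 * Wq (2 * t).+1 1 /\
  Bcst q false 2 n * Wq (2 * t).+1 1 = Qq (2 * t).+2.
Proof.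
move=> ->.
rewrite /Acst /Bcst (_ : (5 * _ - _ - 5) %/ 4 = t * t * 5 + t * 13 + 7)%N; last by lia.
rewrite (_ : (_ - 1) %/ 2 = t.+1)%N; last by lia.
rewrite (_ : ((_ - 1) ^ 2) %/ 4 = t * t * 1 + t * 2 + 1)%N; last by lia.
rewrite (_ : (_ - 1) = 2 * t + 2)%N; last by lia.
rewrite /gauss big_nat1 !subn0 prododdS prodevenS.
rewrite !expq /Stabq /Qq /Wq (addn1 (2 * t).+1) GLq_2t1 GLq_2t2 GLq_1 Symq_2t1 bin_2t2 !muln1
  !mul1n (_ : 'C(1, 2) = 0)%N //.
rewrite -[(2 * t).+2]addn2 -[(2 * t).+1]addn1 q4t !q2t /=.
have := qB1_neq0; have := x_neq0; have := y_neq0; move: x y p e => X Y P E x0 y0 q0.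
by split; field; rewrite ?x0 ?y0 ?q0.
Qed.

(** The extra q (q + 1) is the common factor of [levi_dev_rho2]: q + 1 is the order of SO^-(2,q),
    and q comes from [sum_dev_GL2]. *)
Lemma numeric_p4 : n = (2 * t).+4 ->
  Acst q true 4 n * Stabq (2 * t).+1 2 = Qq (2 * t).+3 * Wq (2 * t).+1 2 * (q * (q + 1)) /\
  Bcst q true 4 n * Wq (2 * t).+1 2 * (q * (q + 1)) = Qq (2 * t).+3.
Proof.
move=> ->.
rewrite /Acst /Bcst (_ : (5 * _ - _ - 4) %/ 4 = t * t * 5 + t * 17 + 13)%N; last by lia.
rewrite (_ : (_ - 1) = 2 * t + 3)%N; last by lia.
rewrite (_ : (_ - 2) %/ 2 = t.+1)%N; last by lia.
rewrite (_ : (_ ^ 2) %/ 4 = t * t * 1 + t * 2 + 1)%N; last by lia.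
rewrite /gauss big_nat_recr //= big_nat1 !subn0 prododdS prodevenS (_ : 2 * t + 3 - 1 = 2 * t +
  2)%N; last by lia.
rewrite !expq /Stabq /Qq /Wq (addn2 (2 * t).+1) GLq_2t1 GLq_2t3 GLq_2 Symq_2t1 bin_2t3 binn.
rewrite -[(2 * t).+3]addn3 -[(2 * t).+1]addn1 (mulnC _ 2%N) !q4t !q2t /=.
have := qB1_neq0; have := qqB1_neq0; have := x_neq0; have := y_neq0.
move: x y p e => X Y P E y0 x0 qq0 q0.
by split; field; rewrite ?x0 ?y0 ?q0 ?qq0.
Qed.

Lemma numeric_m4 : n = (2 * t).+3 ->
  Acst q false 4 n * Stabq (2 * t) 2 = Qq (2 * t).+2 * Wq (2 * t) 2 * (q * (q + 1)) /\
  Bcst q false 4 n * Wq (2 * t) 2 * (q * (q + 1)) = Qq (2 * t).+2.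
Proof.
move=> ->.
rewrite /Acst /Bcst (_ : (5 * _ - _ - 9) %/ 4 = t * t * 5 + t * 13 + 6)%N; last by lia.
rewrite (_ : (_ - 3) %/ 2 = t)%N; last by lia.
rewrite (_ : ((_ - 3) ^ 2) %/ 4 = t * t * 1 + t * 0 + 0)%N; last by lia.
rewrite (_ : (_ - 1) = 2 * t + 2)%N; last by lia.
rewrite (_ : (_ - 2) = 2 * t + 1)%N; last by lia.
rewrite /gauss big_nat_recr //= big_nat1 !subn0 (_ : 2 * t + 2 - 1 = 2 * t + 1)%N; last by lia.
rewrite !expq /Stabq /Qq /Wq addn2 GLq_2t GLq_2t2 GLq_2 Symq_2t bin_2t2 binn.
rewrite -[(2 * t).+2]addn2 (mulnC _ 2%N) q4t0 !q4t !q2t ?q2t0 /=.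
have := qB1_neq0; have := qqB1_neq0; have := x_neq0; have := y_neq0.
move: x y p e => X Y P E y0 x0 qq0 q0.
by split; field; rewrite ?x0 ?y0 ?q0 ?qq0.
Qed.
End ClosedForms.

(** From i = 2 to i = 3 the factor q + 1 moves from B to A. The product stays, as multiplication by
    rho preserves the size of the coset. *)
Lemma Acst3 q pm n : Acst q pm 3 n = (q + 1) * Acst q pm 2 n.
Proof. by case: pm. Qed.

Lemma Bcst3 q pm n : (q + 1) * Bcst q pm 3 n = Bcst q pm 2 n.
Proof. by case: pm; rewrite /= !mulrA. Qed.

Section Cardinals.
Variables (F : finFieldType) (char3 : 3%:R = 0 :> F).
Local Notation q := (#|F|%:R : rat).

Lemma card_F_gt1 : 1 < q.
Proof.
rewrite ltr1n (cardD1 0) (cardD1 1) !inE oner_eq0 /=.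
by [].
Qed.

Lemma natr_card_B1 n : ((#|F| ^ n - 1)%N)%:R = q ^+ n - 1.
Proof.
rewrite natrB ?natrX // expn_gt0; apply/orP; left.
by apply/card_gt0P; exists 0.
Qed.

Lemma glq n : (gl F n)%:R = GLq q n.
Proof.
rewrite /gl card_unitmx natrM natrX natr_prod; congr (_ * _).
by apply: eq_bigr => i _; rewrite natr_card_B1.
Qed.

Lemma naltq n : (nalt F n)%:R = q ^+ 'C(n, 2).
Proof. by rewrite (card_alt (two_neq0 char3)) natrX. Qed.

(** The closed form depends on parity while the recursion reaches back two sizes, so both parities
    go through one induction. *)
Lemma nsym_pair t : (nsym F (2 * t))%:R = Symq q (2 * t) /\
  (nsym F (2 * t).+1)%:R = Symq q (2 * t).+1.
Proof.
have B1 : ((#|F| - 1)%N)%:R = q - 1 := natr_card_B1 1.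
have rec r : (nsym F r.+2)%:R = (q - 1) * q ^+ r.+1 * (nsym F r.+1)%:R +
   (q ^+ r.+1 - 1) * q ^+ r.+1 * (nsym F r)%:R.
  by rewrite (nsym_rec F) natrD !natrM natrX natr_card_B1 B1.
elim: t => [|t [IH0 IH1]].
  rewrite (nsym0 F) (nsym1 F) B1 (Symq_2t q 0) (Symq_2t1 q 0).
  by rewrite /prododd big_geq //= !expr0; split; ring.
have e2 : (nsym F (2 * t.+1))%:R = Symq q (2 * t.+1).
  rewrite (_ : 2 * t.+1 = (2 * t).+2)%N; last by lia.
  rewrite rec IH0 IH1 Symq_2t Symq_2t1 (q2tS _ t 1).
  rewrite (_ : (2 * t).+2 = 2 * t.+1)%N; last by lia.
  rewrite Symq_2t prododdS q2t (_ : t.+1 * t.+1 = t * t * 1 + t * 2 + 1)%N ?expq ?[q ^+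
    t.+1]exprS; last by lia.
  ring.
split=> //.
rewrite (_ : (2 * t.+1).+1 = (2 * t).+3)%N; last by lia.
rewrite rec (_ : (2 * t).+2 = 2 * t.+1)%N; last by lia.
rewrite e2 IH1 (_ : (2 * t.+1).+1 = 1 + 2 * t.+1)%N // Symq_2t1 Symq_2t [q ^+ (2 * t.+1)]q2t0.
rewrite Symq_2t1 prododdS q2t (_ : t.+1 * t.+1 = t * t * 1 + t * 2 + 1)%N ?expq ?[q ^+
  t.+1]exprS; last by lia.
ring.
Qed.

Lemma nsymq r : (nsym F r)%:R = Symq q r.
Proof.
have [e o] := nsym_pair r./2.
have := odd_double_half r; rewrite -mul2n; case: (odd r) => /= <-.
  exact: o.
exact: e.
Qed.
End Cardinals.

(** * The weight distribution *)

Section Assembly.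
Variables (F : finFieldType) (char3 : 3%:R = 0 :> F).
Variables (eps : F) (epsN : ~~ issq eps).
Local Notation q := (#|F|%:R : rat).

Section TraceCount.
Variables r k : nat.
Local Notation Q := (Qgrp (r + k).+1 eps).
Local Notation sg := (sigmab F r k).

Definition trace_count (t b : F) : nat :=
  #|[set g in dbl_coset Q sg | \tr (rhob r k t *m g) == b]|.

Definition levi_dev (t b : F) : rat :=
  \sum_(X : 'M[F]_k | X \in unitmx) \sum_(i in SOm2 eps)
    dev (\tr X + \tr (invmx X) + \tr (diag2 t *m i) - b).

Lemma card_QgrpE : #|Q|%:R = Qq q (r + k).
Proof.
rewrite -sum1_card sum_Qgrp.
under eq_bigr => A _.
  under eq_bigr => i _.
    under eq_bigr => h _.
      rewrite big_mkcond (eq_bigr (fun B => nat_of_bool (B^T + B + h^T *m deltaeps eps *m h ==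
        0))); last first.
        by move=> B _; case: ifP.
      rewrite (sum_alt_shift char3 (tr_hdh _ _)).
      over.
    rewrite sum_nat_const card_mx.
    over.
  rewrite sum_nat_const (card_SOm2 (two_neq0 char3) epsN).
  over.
rewrite sum_nat_const /Qq -(glq F) -(naltq char3) !natrM natrD natrX /gl cardsE.
by rewrite /= ; ring.
Qed.

Lemma conj_stabE : #|conj_stab Q sg|%:R = Stabq q r k.
Proof.
rewrite (card_conj_stab char3 epsN) /Stabq -!(glq F) -(naltq char3).
by rewrite !natrM natrD !natrX.
Qed.

Lemma card_dbl_cosetE : Stabq q r k * #|dbl_coset Q sg|%:R = Qq q (r + k) ^+ 2.
Proof.
rewrite -conj_stabE -card_QgrpE -natrM -natrX -mulnn; congr (_%:R).
symmetry; apply: card_dbl_coset; [exact: Qgrp1|exact: Qgrp_unit|exact: QgrpM|exact: sigmabK].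
Qed.

Lemma trace_countE (t b : F) : t * t = 1 ->
  Stabq q r k * (q * (trace_count t b)%:R - #|dbl_coset Q sg|%:R) =
  Qq q (r + k) * Wq q r k * (-1) ^+ r * levi_dev t b.
Proof.
move=> tt; rewrite /trace_count -sum_dev_fiber -conj_stabE.
rewrite (sum_dev_dbl_coset (Qgrp1 _ _) (Qgrp_unit epsN (m := _)) (@QgrpM F eps _) (sigmabK F r
  k) b (rhobK r k tt) (@rhob_Qgrp F r k eps t tt)).
have E : (nalt F (r + k) * #|F| ^ (2 * k) * #|F| ^ (k * r) * nsym F r)%:R * (- q) ^+ r =
  Wq q r k * (-1) ^+ r.
  by rewrite /Wq -(naltq char3) -nsymq [(- q) ^+ r]exprNn !natrM !natrX mulrCA mulrC.
by rewrite card_QgrpE (sum_dev_Qgrp char3 epsN) -/(levi_dev t b) E;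
  move: (Qq _ _) (Wq _ _ _) => x y; rewrite !mulrA.
Qed.

Lemma Stabq_neq0 : Stabq q r k != 0.
Proof.
rewrite -conj_stabE pnatr_eq0 -lt0n; apply/card_gt0P; exists 1%:M.
by rewrite inE mulmx1 sigmabK !Qgrp1.
Qed.

(** Here u collects the common factor of the Levi sum. In particular the rational q^-1 A (B + x) is
    a natural number, so [multi] is never evaluated at its default for other arguments. *)
Lemma trace_count_affine (A B u x : rat) (t b : F) : t * t = 1 ->
  A * Stabq q r k = Qq q (r + k) * Wq q r k * u ->
  B * Wq q r k * u = Qq q (r + k) ->
  (-1) ^+ r * levi_dev t b = x * u ->
  (trace_count t b)%:R = q^-1 * A * (B + x).
Proof.
move=> tt; have := trace_countE b tt; have := card_dbl_cosetE.
have := Stabq_neq0; have := card_field_neq0 F; move: q (Stabq _ _ _) (Qq _ _) (Wq _ _ _).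
move: (levi_dev t b) (trace_count t b)%:R (#|dbl_coset Q sg|%:R) ((-1) ^+ r).
move=> L N D s q' S QQ W q0 S0 hD hN hA hB hx.
apply: (mulfI q0); apply: (mulfI S0).
(* The deviation part yields Q W u x, and the size of the coset yields Q^2 = Q W u B. *)
transitivity (S * (q' * N - D) + S * D); first by ring.
rewrite hN hD -mulrA hx.
transitivity (QQ * W * u * (B + x)); first by rewrite expr2 -[X in _ + _ * X = _]hB; ring.
by rewrite -hA; field.
Qed.

Lemma dcosetE : dcoset (r + k).+1 eps r = dbl_coset Q sg.
Proof. by rewrite /dcoset sigmaE. Qed.

Lemma card_trace_dcoset b :
  #|[set g in dcoset (r + k).+1 eps r | \tr g == b]| = trace_count 1 b.
Proof.
rewrite dcosetE /trace_count; apply: eq_card => g; rewrite !inE.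
by rewrite rhob1 mul1mx.
Qed.

Lemma card_trace_rho_dcoset b :
  #|[set g in [set rho F (r + k).+1 *m g | g in dcoset (r + k).+1 eps r] | \tr g == b]| =
  trace_count (-1) b.
Proof.
rewrite dcosetE rhobN1 /trace_count.
have NN : -1 * -1 = 1 :> F by rewrite mulrNN mulr1.
have rK : cancel (mulmx (rhob r k (-1 : F))) (mulmx (rhob r k (-1 : F)) : 'M_(r + k + (r + k) +
  2) -> _).
  by move=> g; rewrite mulmxA rhobK // mul1mx.
rewrite -[RHS](card_imset _ (can_inj rK)); apply: eq_card => g.
rewrite inE; apply/andP/imsetP => [[/imsetP[g' g'D ->] trg]|[g']].
  by exists g' => //; rewrite inE g'D.
by rewrite inE => /andP[g'D trg] ->; split=> //; apply: imset_f.
Qed.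
End TraceCount.

Lemma Ccount_dcoset n r k j : n = (r + k).+1 ->
  Ccount (dcoset n eps r) j =
  famsum j (fun nu mu => \prod_(b : F) multi (trace_count r k 1%R b)%:R (nu b) (mu b))%N.
Proof.
move=> ->; rewrite (Ccount_famsum char3); apply: eq_famsum => nu mu.
by apply: eq_bigr => b _; rewrite card_trace_dcoset.
Qed.

Lemma Ccount_rho_dcoset n r k j : n = (r + k).+1 ->
  Ccount [set rho F n *m g | g in dcoset n eps r] j =
  famsum j (fun nu mu => \prod_(b : F) multi (trace_count r k (-1)%R b)%:R (nu b) (mu b))%N.
Proof.
move=> ->; rewrite (Ccount_famsum char3); apply: eq_famsum => nu mu.
by apply: eq_bigr => b _; rewrite card_trace_rho_dcoset.
Qed.

(** The value of [sum_dev_recip], the sum for the split torus, to which the cases i = 1 and i = 3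
    both reduce. *)
Definition root_dev (b : F) : rat := q * (nroots (b ^+ 2 - 1))%:R - (q - 1).

Lemma diag2_1 : diag2 (1 : F) = 1%:M.
Proof. by apply/matrixP=> i j; rewrite !mxE; case: ifP => //; rewrite if_same. Qed.

(** The product is a reflection. So with rho present, SO^-(2,q) contributes only its order q + 1 to
    the Levi sum. *)
Lemma tr_diag2N1 i : i \in SOm2 eps -> \tr (diag2 (-1) *m i) = 0.
Proof.
case/SOm2P=> -[a c] _ -> /=; rewrite tr2 !mxE !big_ord_recl !big_ord0 !mxE /=.
by ring.
Qed.

Lemma levi_dev_0 (b : F) : levi_dev 0 1 b = - root_dev b.
Proof.
rewrite /levi_dev (big_pred1 0) => [|X]; last first.
  by rewrite /= [X]thinmx0 unitmxE det_mx00 unitr1 eqxx.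
rewrite (eq_bigr (fun i => dev (\tr i - b))) => [|i _]; last first.
  by rewrite [invmx _]thinmx0 !linear0 addr0 add0r diag2_1 mul1mx.
rewrite (sum_dev_SOm2 char3 epsN) /root_dev.
have := nroots_twist (two_neq0 char3) epsN (b ^+ 2 - 1).
by move/(congr1 (GRing.natmul (1 : rat))); rewrite natrD => /(canRL (addKr _)) ->; ring.
Qed.

Lemma sum_unitmx1 (V : nmodType) (phi : 'M[F]_1 -> V) :
  \sum_(X : 'M[F]_1 | X \in unitmx) phi X = \sum_(a : F | a != 0) phi a%:M.
Proof.
rewrite big_mkcond sum_mx11 [RHS]big_mkcond; apply: eq_bigr => a _.
by rewrite unitmxE det_scalar1 unitfE.
Qed.

Lemma levi_dev_1 (b : F) : levi_dev 1 1 b = (q - 1) ^+ 2 - q * (delta2 b)%:R.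
Proof.
rewrite /levi_dev sum_unitmx1 -(sum_dev_recip_SOm2 char3 epsN).
apply: eq_bigr => a a0; apply: eq_bigr => i _.
by rewrite invmx_scalar !mxtrace_scalar diag2_1 mul1mx.
Qed.

Lemma levi_dev_rho k (b : F) : levi_dev k (-1) b =
  (q + 1) * \sum_(X : 'M[F]_k | X \in unitmx) dev (\tr X + \tr (invmx X) - b).
Proof.
rewrite /levi_dev mulr_sumr; apply: eq_bigr => X _.
rewrite (eq_bigr (fun _ => dev (\tr X + \tr (invmx X) - b))) => [|i iS]; last first.
  by rewrite tr_diag2N1 // addr0.
by rewrite sumr_const (card_SOm2 (two_neq0 char3) epsN) -[LHS]mulr_natl natrD.
Qed.

Lemma levi_dev_rho1 (b : F) : levi_dev 1 (-1) b = (q + 1) * root_dev b.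
Proof.
rewrite levi_dev_rho sum_unitmx1 /root_dev -(sum_dev_recip char3); congr (_ * _).
by apply: eq_bigr => a a0; rewrite invmx_scalar !mxtrace_scalar.
Qed.

Lemma levi_dev_rho2 (b : F) : levi_dev 2 (-1) b = q * (q + 1) *
  (q * (delta2 b)%:R - 2 * q ^+ 2 + 3 * q - 1 + (q ^+ 3 - q ^+ 2) * (b == 0)%:R).
Proof. by rewrite levi_dev_rho (sum_dev_GL2 char3) mulrA [_ * q]mulrC. Qed.

Lemma root_dev1 b : b ^+ 2 - 1 = 0 -> root_dev b = 1.
Proof. by rewrite /root_dev => ->; rewrite nroots0; ring. Qed.

Lemma root_dev_sq b : b ^+ 2 - 1 != 0 -> issq (b ^+ 2 - 1) -> root_dev b = q + 1.
Proof.
rewrite /root_dev; move: (b ^+ 2 - 1) => c c0 /existsP[y /eqP yc].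
rewrite -yc -expr2 (nroots_sq (two_neq0 char3)); first by ring.
by apply: contraNneq c0 => y0; rewrite -yc y0 mul0r.
Qed.

Lemma root_dev_nsq b : ~~ issq (b ^+ 2 - 1) -> root_dev b = 1 - q.
Proof. by move=> bN; rewrite /root_dev nroots_nsq //; ring. Qed.

(** The roots of b^2 - 1 are 1 and -1, distinct since 2 is nonzero. As [issq] holds at 0, they stay
    out of the nonsquare product. *)
Lemma prod_by_root_dev (g : F -> nat) :
  (\prod_b g b = g 1%R * g (-1)%R *
    (\prod_(b | ((b ^+ 2 - 1 != 0) && issq (b ^+ 2 - 1))%R) g b) *
    (\prod_(b | (~~ issq (b ^+ 2 - 1))%R) g b))%N.
Proof.
have N11 : -1 != 1 :> F.
  by rewrite -subr_eq0 -opprD oppr_eq0 -[1 + 1]/(2%:R) (two_neq0 char3).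
have sq0 : issq (0 : F) by apply/existsP; exists 0; rewrite mulr0.
have root (b : F) : (b ^+ 2 - 1 == 0) = (b == 1) || (b == -1).
  by rewrite subr_eq0 sqrf_eq1.
rewrite (bigD1 1) //= (bigD1 (-1)) //= mulnA -[RHS]mulnA; congr (_ * _)%N.
rewrite (bigID (fun b => issq (b ^+ 2 - 1))) /=; congr (_ * _)%N; apply: eq_bigl => b.
  by rewrite root negb_or.
have [->|] := eqVneq (b ^+ 2 - 1) 0; first by rewrite sq0 andbF.
by rewrite root negb_or => ->.
Qed.

Lemma famsum_root_dev (c : F -> rat) (c1 cs cn : rat) j :
  (forall b, b ^+ 2 - 1 = 0 -> c b = c1) ->
  (forall b, b ^+ 2 - 1 != 0 -> issq (b ^+ 2 - 1) -> c b = cs) ->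
  (forall b, ~~ issq (b ^+ 2 - 1) -> c b = cn) ->
  famsum j (fun nu mu => \prod_(b : F) multi (c b) (nu b) (mu b))%N =
  famsum j (fun nu mu =>
      (multi c1 (nu (1%R : F)) (mu (1%R : F)) *
       multi c1 (nu ((-1)%R : F)) (mu ((-1)%R : F)) *
       (\prod_(b : F | ((b ^+ 2 - 1 != 0) && issq (b ^+ 2 - 1))%R)
          multi cs (nu b) (mu b)) *
       (\prod_(b : F | (~~ issq (b ^+ 2 - 1))%R)
          multi cn (nu b) (mu b)))%N).
Proof.
move=> h1 hs hn; apply: eq_famsum => nu mu; rewrite prod_by_root_dev.
rewrite !h1 ?sqrrN ?expr1n ?subrr //; congr (_ * _ * _)%N; apply: eq_bigr => b.
  by case/andP=> b0 bs; rewrite hs.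
by move=> bn; rewrite hn.
Qed.

(** The cases i = 1 and i = 3 share a proof because the Levi sum is a multiple of [root_dev] in
    both; s is the sign eta. *)
Lemma rhs_root (pm : bool) (i n j r k : nat) (t : F) (u : rat) :
  (i == 1%N) || (i == 3%N) -> t * t = 1 ->
  let s : rat := if pm then 1 else -1 in
  Acst q pm i n * Stabq q r k = Qq q (r + k) * Wq q r k * u ->
  Bcst q pm i n * Wq q r k * u = Qq q (r + k) ->
  (forall b, (-1) ^+ r * levi_dev k t b = s * root_dev b * u) ->
  famsum j (fun nu mu => \prod_(b : F) multi (trace_count r k t b)%:R (nu b) (mu b))%N =
  rhs F pm i n j.
Proof.
move=> i13 tt s hA hB hx.
have cE b := trace_count_affine tt hA hB (hx b).
rewrite (famsum_root_dev (c1 := q^-1 * Acst q pm i n * (Bcst q pm i n + s))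
  (cs := q^-1 * Acst q pm i n * (Bcst q pm i n + s * (q + 1)))
  (cn := q^-1 * Acst q pm i n * (Bcst q pm i n + s * (1 - q)))).
- by case/orP: i13 => /eqP ->.
- by move=> b b0; rewrite cE root_dev1 // mulr1.
- by move=> b b0 bs; rewrite cE root_dev_sq.
- by move=> b bn; rewrite cE root_dev_nsq.
Qed.

Lemma rhs_2 (pm : bool) (n j r : nat) :
  let s : rat := if pm then 1 else -1 in
  Acst q pm 2 n * Stabq q r 1 = Qq q (r + 1) * Wq q r 1 ->
  Bcst q pm 2 n * Wq q r 1 = Qq q (r + 1) -> (-1) ^+ r = s ->
  famsum j (fun nu mu => \prod_(b : F) multi (trace_count r 1 1%R b)%:R (nu b) (mu b))%N =
  rhs F pm 2 n j.
Proof.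
move=> s hA hB hs; apply: eq_famsum => nu mu; apply: eq_bigr => b _; congr multi.
apply: (trace_count_affine (u := 1)); rewrite ?mulr1 //.
by rewrite levi_dev_1 hs.
Qed.

Lemma rhs_4 (pm : bool) (n j r : nat) :
  let s : rat := if pm then 1 else -1 in
  Acst q pm 4 n * Stabq q r 2 = Qq q (r + 2) * Wq q r 2 * (q * (q + 1)) ->
  Bcst q pm 4 n * Wq q r 2 * (q * (q + 1)) = Qq q (r + 2) -> (-1) ^+ r = - s ->
  famsum j (fun nu mu => \prod_(b : F) multi (trace_count r 2 (-1)%R b)%:R (nu b) (mu b))%N =
  rhs F pm 4 n j.
Proof.
move=> s hA hB hs; apply: eq_famsum => nu mu; rewrite (bigD1 0) //=.
have NN : -1 * -1 = 1 :> F by rewrite mulrNN mulr1.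
congr (multi _ _ _ * _)%N; last (apply: eq_bigr => b b0; congr multi).
  apply: (trace_count_affine NN hA hB); rewrite levi_dev_rho2 hs eqxx mulr1n /s.
  by case: (pm); ring.
apply: (trace_count_affine NN hA hB); rewrite levi_dev_rho2 hs (negPf b0) mulr0n /s.
by case: (pm); ring.
Qed.
End Assembly.

Theorem theorem18 (s : nat) (F : finFieldType) (hs : (0 < s)%N) (hF : #|F| = (3 ^ s)%N)
  (eps : F) (heps : ~~ issq eps)
  (pm : bool) (i n : nat) (hn : valid pm i n)
  (j : nat)
  (hj : (j%:R : rat) <= Acst (#|F|)%:R pm i n * Bcst (#|F|)%:R pm i n) :
  Ccount (DC i n eps) j = rhs F pm i n j.
Proof.
have char3 : 3%:R = 0 :> F by case/andP: (card_finPcharP hF isT) => _ /eqP.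
have q1 := card_F_gt1 F.
have NN : -1 * -1 = 1 :> F by rewrite mulrNN mulr1.
have sgn0 t : (-1) ^+ (2 * t) = 1 :> rat by rewrite mul2n -signr_odd odd_double.
have sgn1 t : (-1) ^+ (2 * t).+1 = -1 :> rat by rewrite exprS sgn0 mulr1.
have DC1 r : n.-1 = r -> DC 1 n eps = dcoset n eps r by move=> <-.
have DC2 r : n.-1.-1 = r -> DC 2 n eps = dcoset n eps r by move=> <-.
have DC3 r : n.-1.-1 = r -> DC 3 n eps = [set rho F n *m g | g in dcoset n eps r] by move=> <-.
have DC4 r : n.-1.-1.-1 = r -> DC 4 n eps = [set rho F n *m g | g in dcoset n eps r] by move=> <-.
(* The relations for i = 3 are those for i = 2 with u = q + 1. *)
have num3 b W S QQ : Acst (#|F|)%:R b 2 n * S = QQ * W -> Bcst (#|F|)%:R b 2 n * W = QQ ->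
   Acst (#|F|)%:R b 3 n * S = QQ * W * (#|F|%:R + 1) /\ Bcst (#|F|)%:R b 3 n * W * (#|F|%:R +
     1) = QQ.
  rewrite Acst3 => hA hB; split; first by rewrite -mulrA hA mulrC.
  by rewrite -hB -Bcst3; ring.
(* Below n = r + k + 1, with k = 0 for i = 1, k = 1 for i = 2, 3 and k = 2 for i = 4; the parity of
   r, fixed by that of n, combines with the sign of the Levi sum to give eta. *)
have half : exists t, n = (2 * t + odd n)%N by exists n./2; lia.
case: half => t0 nE; move: hn; rewrite /valid; case: pm {hj} => /andP[on].
  move: nE; rewrite (negPf on) addn0 => nE.
  have n2 t : t0 = t.+1 -> n = (2 * t).+2 by lia.
  case/orP=> /andP[]; last first.
    move=> /eqP-> n4; have [t tE] : exists t, t0 = t.+2 by exists t0.-2; lia.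
    have n4E : n = (2 * t).+4 by lia.
    rewrite (DC4 (2 * t).+1); last by lia.
    rewrite (Ccount_rho_dcoset char3 eps (k := 2)); last by lia.
    have [hA hB] := numeric_p4 q1 n4E.
    by apply: (rhs_4 char3 heps); rewrite // ?addn2 // sgn1.
  move=> i123 n2'; have [t tE] : exists t, t0 = t.+1 by exists t0.-1; lia.
  have {}n2 := n2 _ tE; move: i123; rewrite !inE => /or3P[] /eqP->.
  - rewrite (DC1 (2 * t).+1); last by lia.
    rewrite (Ccount_dcoset char3 eps (k := 0)); last by lia.
    have [hA hB] := numeric_p1 q1 n2.
    apply: (rhs_root char3 heps j (u := 1)); rewrite ?addn0 ?mulr1 // => b.
    by rewrite (levi_dev_0 char3 heps) sgn1; ring.
  - rewrite (DC2 (2 * t)%N); last by lia.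
    rewrite (Ccount_dcoset char3 eps (k := 1)); last by lia.
    have [hA hB] := numeric_p2 q1 n2.
    by apply: (rhs_2 char3 heps); rewrite ?addn1 ?sgn0.
  - rewrite (DC3 (2 * t)%N); last by lia.
    rewrite (Ccount_rho_dcoset char3 eps (k := 1)); last by lia.
    have [hA hB] := numeric_p2 q1 n2; have [hA' hB'] := num3 _ _ _ _ hA hB.
    apply: (rhs_root char3 heps j (u := #|F|%:R + 1)); rewrite ?addn1 // => b.
    by rewrite (levi_dev_rho1 char3 heps) sgn0; ring.
move: nE; rewrite on => nE.
case/orP=> /andP[].
  move=> /eqP-> _; have n1 : n = (2 * t0).+1 by lia.
  rewrite (DC1 (2 * t0)%N); last by lia.
  rewrite (Ccount_dcoset char3 eps (k := 0)); last by lia.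
  have [hA hB] := numeric_m1 q1 n1.
  apply: (rhs_root char3 heps j (u := 1)); rewrite ?addn0 ?mulr1 // => b.
  by rewrite (levi_dev_0 char3 heps) sgn0; ring.
move=> i234 n3; have [t tE] : exists t, t0 = t.+1 by exists t0.-1; lia.
have n3E : n = (2 * t).+3 by lia.
move: i234; rewrite !inE => /or3P[] /eqP->.
- rewrite (DC2 (2 * t).+1); last by lia.
  rewrite (Ccount_dcoset char3 eps (k := 1)); last by lia.
  have [hA hB] := numeric_m2 q1 n3E.
  by apply: (rhs_2 char3 heps); rewrite ?addn1 ?sgn1.
- rewrite (DC3 (2 * t).+1); last by lia.
  rewrite (Ccount_rho_dcoset char3 eps (k := 1)); last by lia.
  have [hA hB] := numeric_m2 q1 n3E; have [hA' hB'] := num3 _ _ _ _ hA hB.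
  apply: (rhs_root char3 heps j (u := #|F|%:R + 1)); rewrite ?addn1 // => b.
  by rewrite (levi_dev_rho1 char3 heps) sgn1; ring.
rewrite (DC4 (2 * t)%N); last by lia.
rewrite (Ccount_rho_dcoset char3 eps (k := 2)); last by lia.
have [hA hB] := numeric_m4 q1 n3E.
by apply: (rhs_4 char3 heps); rewrite ?addn2 // sgn0 opprK.
Qed.
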